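(* (1) There exists a loopless matroid $\mathsf{M}$ such that the sequence of coefficients of $\mathrm{H}_\mathsf{M}^{\mathcal{G}_{\min}}(x)$ is not log-concave. (2) There exists $N$ such that for every $n\ge N$ there is a building set $\mathcal{G}$ on the Boolean matroid $\mathsf{U}_{n,n}$ for which the sequence of coefficients of $\mathrm{H}_{\mathsf{U}_{n,n}}^{\mathcal{G}}(x)$ is not log-concave.
   Context: A matroid $\mathsf{M}=(E,\operatorname{rk})$ is a polymatroid (finite $E$, $\operatorname{rk}:2^E\to\mathbb{Z}_{\ge0}$ with $\operatorname{rk}(\varnothing)=0$, monotone, submodular) with $\operatorname{rk}(A)\le|A|$ for all $A$. Flats: $F$ with $\operatorname{rk}(F\cup\{e\})>\operatorname{rk}(F)$ for $e\notin F$; lattice $\mathcal L(\mathsf{M})$ with join $\vee$; loopless means $\varnothing$ is a flat. The Boolean matroid $\mathsf{U}_{n,n}$ has ground set $[n]$ and $\operatorname{rk}(A)=|A|$. $f(\mathcal{G})$ = inclusion-maximal elements of a set $\mathcal{G}$ of flats, $\mathcal{G}_{\le F}=\{G\in\mathcal{G}:G\subseteq F\}$. A building set is $\mathcal{G}\subseteq\mathcal L(\mathsf{M})\setminus\{\varnothing\}$ such that for every flat $F$ the map $\prod_{G\in f(\mathcal{G}_{\le F})}[\varnothing,G]\to[\varnothing,F]$, $(F_G)\mapsto\bigvee F_G$, is a lattice isomorphism and $\operatorname{rk}(F)=\sum_{G\in f(\mathcal{G}_{\le F})}\operatorname{rk}(G)$. $\mathcal{G}_{\min}$ is the building set of nonempty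 flats $F$ for which $\mathcal L(\mathsf{M}|_F)\cong[\varnothing,F]$ is not isomorphic to a product of two nontrivial lattices (connected flats). The Chow ring $D(\mathsf{M},\mathcal{G})$ is $\mathbb{Q}[x_G:G\in\mathcal{G}]$ (degree-1 generators) modulo the ideal generated by $\big(\prod_{i=1}^m x_{G_i}\big)\big(\sum_{H\in\mathcal{G},H\supseteq G}x_H\big)^{\operatorname{rk}(G)-\operatorname{rk}(\sup(S,G))}$ for each subset $S=\{G_1,\dots,G_m\}\subseteq\mathcal{G}$ and $G\in\mathcal{G}$, where $\sup(S,G)=\bigvee_{G'\in S,\,G'\subsetneq G}G'$; $\mathrm{H}_\mathsf{M}^{\mathcal{G}}(x)=\sum_i\dim D^i(\mathsf{M},\mathcal{G})x^i$. A sequence $(a_0,\dots,a_d)$ is log-concave if $a_i^2\ge a_{i-1}a_{i+1}$ for all $0<i<d$. *)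

(* Defs.v *)
From mathcomp Require Import all_boot all_order all_algebra.
From mathcomp Require Import boolp.
From mathcomp Require Import mpoly.

Set Implicit Arguments.
Unset Strict Implicit.
Unset Printing Implicit Defensive.

Import Order.TTheory GRing.Theory Num.Theory.

Record matroid (E : finType) := Matroid {
  rk :> {set E} -> nat;
  rk0 : rk set0 = 0;
  rkS : forall A B : {set E}, A \subset B -> rk A <= rk B;
  rk_submod : forall A B : {set E}, rk (A :|: B) + rk (A :&: B) <= rk A + rk B;
  rk_card : forall A : {set E}, rk A <= #|A|
}.

Section Flats.

Variables (E : finType) (M : matroid E).

Definition flat (F : {set E}) : bool :=
  [forall e, (e \notin F) ==> (M F < M (e |: F))].

Definition loopless : bool := flat set0.

(* The join of a family of flats in the lattice of flats is [span] of its
   union: the least flat containing every member. *)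
Definition span (A : {set E}) : {set E} :=
  \bigcap_(F : {set E} | flat F && (A \subset F)) F.

Lemma flatI (F1 F2 : {set E}) : flat F1 -> flat F2 -> flat (F1 :&: F2).
Proof.
have aux (F F' : {set E}) e : F' \subset F -> e \notin F -> flat F ->
    M F' < M (e |: F').
  move=> sF'F eF /forallP/(_ e); rewrite eF /= => lt_e.
  have := rk_submod M (e |: F') F.
  have -> : (e |: F') :|: F = e |: F by rewrite -setUA (setUidPr sF'F).
  have -> : (e |: F') :&: F = F'.
    rewrite setIUl (setIidPl sF'F); apply/setUidPr/subsetP => x.
    by rewrite !inE => /andP[/eqP-> xF]; rewrite xF in eF.
  move=> le_s; rewrite -(ltn_add2r (M F)); apply: leq_trans le_s.
  by rewrite addnC ltn_add2r.
move=> fF1 fF2; apply/forallP => e; apply/implyP.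
rewrite inE negb_and => /orP[eF|eF].
  by apply: (@aux F1); rewrite ?subsetIl.
by apply: (@aux F2); rewrite ?subsetIr.
Qed.

Lemma flatT : flat setT.
Proof. by apply/forallP => e; rewrite inE. Qed.

Lemma flat_span (A : {set E}) : flat (span A).
Proof.
by apply: (big_ind flat) => [||F /andP[]//]; [exact: flatT | exact: flatI].
Qed.

Lemma span_min (A F : {set E}) : flat F -> A \subset F -> span A \subset F.
Proof. by move=> fF sAF; apply: bigcap_inf; rewrite fF sAF. Qed.

(* The interval of flats below [F], $[\varnothing, F]$ for a loopless
   matroid. *)
Definition below (F : {set E}) : pred {set E} :=
  fun H => flat H && (H \subset F).

Definition interval (F : {set E}) : Type := {H : {set E} | below F H}.

End Flats.

(* Isomorphisms of lattices, as isomorphisms of the underlying orders. *)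
Definition lattice_iso (S T : Type) (leS : rel S) (leT : rel T) (f : S -> T) :
    Prop :=
  bijective f /\ forall x y : S, leT (f x) (f y) = leS x y.

Section BuildingSets.

Variables (E : finType) (M : matroid E).
Implicit Types (G : {set {set E}}) (F : {set E}).

Definition le_interval F : rel (interval M F) :=
  fun H1 H2 => val H1 \subset val H2.

Definition restrict_le G F : {set {set E}} := [set H in G | H \subset F].

Definition maximal_elts G : {set {set E}} :=
  [set H in G | [forall H' in G, (H \subset H') ==> (H' == H)]].

Definition factor G F : Type :=
  {H : {set E} | H \in maximal_elts (restrict_le G F)}.

Definition interval_prod G F : Type :=
  {dffun forall H : factor G F, interval M (val H)}.

Definition le_interval_prod G F : rel (interval_prod G F) :=
  fun u v => [forall H, le_interval (u H) (v H)].

Lemma join_subproof G F (u : interval_prod G F) (fF : flat M F) :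
  below M F (span M (\bigcup_H val (u H))).
Proof.
rewrite /below flat_span span_min //; apply/bigcupsP => H _.
have /andP[_ /subset_trans] := valP (u H); apply.
by have := valP H; rewrite !inE => /andP[/andP[_]].
Qed.

Definition join_map G F (fF : flat M F) (u : interval_prod G F) :
    interval M F :=
  exist _ (span M (\bigcup_H val (u H))) (join_subproof u fF).

Definition building_set G : Prop :=
  [/\ forall H, H \in G -> flat M H /\ H != set0,
      forall F (fF : flat M F),
        lattice_iso (@le_interval_prod G F) (@le_interval F) (join_map fF)
    & forall F, flat M F ->
        M F = \sum_(H in maximal_elts (restrict_le G F)) M H].

Definition nontrivial_type (T : Type) : Prop := exists x y : T, x <> y.

Definition lattice_decomposable F : Prop :=
  exists (d1 d2 : Order.disp_t) (L1 : latticeType d1) (L2 : latticeType d2)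
         (f : interval M F -> L1 * L2),
    [/\ nontrivial_type L1, nontrivial_type L2
      & lattice_iso (@le_interval F)
          (fun x y : L1 * L2 => (x.1 <= y.1)%O && (x.2 <= y.2)%O) f].

Definition G_min : {set {set E}} :=
  [set F | [&& flat M F, F != set0 & `[< ~ lattice_decomposable F >]]].

End BuildingSets.

Section ChowRing.

Local Open Scope ring_scope.

Variables (E : finType) (M : matroid E) (G : {set {set E}}).

(* The variables of the polynomial ring are numbered by the enumeration of [G]:
   the variable ['X_i] is $x_H$ for [H] the flat [enum_val i]. *)
Local Notation I := 'I_(#|G|).
Local Notation elt i := (@enum_val _ (mem G) i).
Local Notation P := {mpoly rat[#|G|]}.

Definition sup_below (S : {set I}) (g : I) : {set E} :=
  span M (\bigcup_(i in S | elt i \proper elt g) elt i).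

Definition chow_rel (S : {set I}) (g : I) : P :=
  (\prod_(i in S) 'X_i)
  * (\sum_(h : I | elt g \subset elt h) 'X_h)
      ^+ (M (elt g) - M (sup_below S g)).

Definition chow_ideal (p : P) : Prop :=
  exists c : {set I} -> I -> P, p = \sum_S \sum_g c S g * chow_rel S g.

(* The degree [d] component of the Chow ring $\mathbb{Q}[x_H : H \in G]$ modulo
   [chow_ideal] has a basis with [k] elements: the classes of the [b j]. *)
Definition chow_dim (d k : nat) : Prop :=
  exists b : 'I_k -> P,
    [/\ forall j, b j \is d.-homog,
        forall p : P, p \is d.-homog ->
          exists c : 'I_k -> rat, chow_ideal (p - \sum_j c j *: b j)
      & forall c : 'I_k -> rat,
          chow_ideal (\sum_j c j *: b j) -> forall j, c j = 0].

Definition chow_hilbert (h : {poly nat}) : Prop :=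
  forall d : nat, chow_dim d (nth 0%N h d).

End ChowRing.

Definition log_concave (a : seq nat) : Prop :=
  forall i, 0 < i -> i < (size a).-1 ->
    nth 0 a i.-1 * nth 0 a i.+1 <= nth 0 a i ^ 2.

Section BooleanMatroid.

Variable n : nat.

Lemma boolean_rk_submod (A B : {set 'I_n}) :
  #|A :|: B| + #|A :&: B| <= #|A| + #|B|.
Proof. by rewrite cardsUI. Qed.

Definition boolean_matroid : matroid 'I_n :=
  @Matroid _ (fun A => #|A|) (cards0 _) (@subset_leq_card _)
    boolean_rk_submod (fun=> leqnn _).

End BooleanMatroid.

(* Main.v *)
(** For a flag [R1 < R2 < E] of flats of ranks [a], [a + 3], [a + 6] and [N]
   hyperplanes [P f] containing no member of the flag, let [G] consist of the
   atoms, the flag and the hyperplanes.  After elimination of the atoms the Chow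
   ring is generated by [u = x_R1 + x_R2 + x_E], [v = x_R2 + x_E], [w = x_E] and
   the [x_(P f)], subject to [u^a = 0], [v^4 = u v^3], [w^4 = v w^3],
   [x_(P f) u = x_(P f) v = x_(P f) w = x_(P f) x_(P g) = 0] and
   [x_(P f)^(a + 5) = - w^(a + 5)]: blowing up the flag gives a tower of
   projective bundles, and each hyperplane is the blow-up of a point away from
   the flag.  The dimensions in degrees 1, 2, 3 are [N + 3], [N + 6], [N + 10],
   and [(N + 3)(N + 10) > (N + 6)^2] as soon as [N > 6].

   Linear independence follows from a degree map: on [Q[u, v, w]] it is the
   residue with respect to the complete intersection [u^a, v^3(v - u), w^3(w - v)],
   which sends a monomial [u^i v^j w^k] of degree [a + 5] to 1 if [i < a] and
   [i + j < a + 3], and to 0 otherwise.  The pairing of the monomial basis with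
   its complementary monomials is then unitriangular.

   In the Boolean matroid the flag consists of initial segments and the
   hyperplanes are complements of points of [R1].  For the minimal building set,
   the laminar matroid with capacities 4, 7, 10 on nested sets of 5, 9, 79
   elements has exactly the members of the flag as its connected flats of rank at
   least 2; turning seven disjoint bases outside [R2] into circuit-hyperplanes
   adds the [P f]. *)

Require Import Defs.
From mathcomp Require Import all_boot all_order all_algebra.
From HB Require Import structures.
From mathcomp Require Import boolp mpoly zify ring.

Set Implicit Arguments.
Unset Strict Implicit.
Unset Printing Implicit Defensive.

Import Order.TTheory GRing.Theory Num.Theory.

Local Notation span := Defs.span.
Local Notation interval := Defs.interval.

(** * The residue functional on the polynomials in u, v, w *)

Section Residue.

Local Open Scope ring_scope.

Variable a : nat.

Local Notation Q3 := {mpoly rat[3]}.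

Definition o0 : 'I_3 := @Ordinal 3 0 isT.
Definition o1 : 'I_3 := @Ordinal 3 1 isT.
Definition o2 : 'I_3 := @Ordinal 3 2 isT.

Definition vu : Q3 := 'X_o0.
Definition vv : Q3 := 'X_o1.
Definition vw : Q3 := 'X_o2.

Definition mon (i j k : nat) : Q3 := vu ^+ i * vv ^+ j * vw ^+ k.

Definition top_mon (i j k : nat) : bool :=
  [&& i + j + k == a + 5, i < a & i + j < a + 3]%N.

(** [top_mon] forces total degree [a + 5], so restricting to multinomials of degree below [a + 6]
    makes the sum finite without losing a term. *)
Definition residue (p : Q3) : rat :=
  \sum_(m : 'X_{1..3 < a + 6}) (top_mon (m o0) (m o1) (m o2))%:R * p@_m.

Lemma residueD p q : residue (p + q) = residue p + residue q.
Proof.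
rewrite /residue -big_split; apply: eq_bigr => m _.
by rewrite mcoeffD mulrDr.
Qed.

Lemma residueZ c p : residue (c *: p) = c * residue p.
Proof.
by rewrite /residue mulr_sumr; apply: eq_bigr => m _; rewrite mcoeffZ mulrCA.
Qed.

Lemma residue0 : residue 0 = 0.
Proof. by rewrite -(scale0r (0 : Q3)) residueZ mul0r. Qed.

Lemma residueN p : residue (- p) = - residue p.
Proof. by rewrite -scaleN1r residueZ mulN1r. Qed.

Lemma residueB p q : residue (p - q) = residue p - residue q.
Proof. by rewrite residueD residueN. Qed.

Lemma residue_sum (T : Type) (r : seq T) (P : pred T) (F : T -> Q3) :
  residue (\sum_(t <- r | P t) F t) = \sum_(t <- r | P t) residue (F t).
Proof. by apply: (big_morph residue residueD residue0). Qed.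

Lemma mpolyX_mon (m : 'X_{1..3}) : 'X_[m] = mon (m o0) (m o1) (m o2).
Proof.
rewrite mpolyXE_id !big_ord_recl big_ord0 mulr1 mulrA /mon.
by congr ('X__ ^+ m _ * 'X__ ^+ m _ * 'X__ ^+ m _); apply: val_inj.
Qed.

Definition mnm3 (i j k : nat) : 'X_{1..3} :=
  (U_(o0) *+ i + U_(o1) *+ j + U_(o2) *+ k)%MM.

Lemma mnm3E i j k :
  [/\ mnm3 i j k o0 = i, mnm3 i j k o1 = j & mnm3 i j k o2 = k].
Proof. by split; rewrite !mnmDE !mulmnE !mnm1E /=; lia. Qed.

Lemma monE i j k : mon i j k = 'X_[mnm3 i j k].
Proof. by rewrite mpolyX_mon; case: (mnm3E i j k) => -> -> ->. Qed.

Lemma mdeg3 (m : 'X_{1..3}) : mdeg m = (m o0 + m o1 + m o2)%N.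
Proof.
rewrite mdegE !big_ord_recl big_ord0 addn0 addnA.
by congr (m _ + m _ + m _)%N; apply: val_inj.
Qed.

Lemma residue_mon i j k : residue (mon i j k) = (top_mon i j k)%:R.
Proof.
case: (mnm3E i j k) => e0 e1 e2.
case: (boolP (top_mon i j k)) => [tm|ntm]; last first.
  rewrite /residue big1 // => m _; rewrite monE mcoeffX.
  by case: eqP => [<-|_]; rewrite ?mulr0 // e0 e1 e2 (negbTE ntm) mul0r.
have lt_m : (mdeg (mnm3 i j k) < a + 6)%N.
  by rewrite mdeg3 e0 e1 e2; move: tm => /and3P[/eqP -> _ _]; lia.
rewrite /residue (bigD1 (BMultinom lt_m)) //= monE mcoeffX eqxx e0 e1 e2 tm.
rewrite big1 ?mulr1 ?addr0 // => m /negbTE ne_m.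
rewrite mcoeffX [_ == _]eq_sym; move: ne_m; rewrite -val_eqE /= => ->.
by rewrite mulr0.
Qed.

Lemma monM i j k i' j' k' :
  mon i j k * mon i' j' k' = mon (i + i') (j + j') (k + k').
Proof. by rewrite /mon !exprD; ring. Qed.

Lemma monXu i j k n : mon i j k * vu ^+ n = mon (i + n) j k.
Proof. by rewrite /mon exprD; ring. Qed.

Lemma monXv i j k n : mon i j k * vv ^+ n = mon i (j + n) k.
Proof. by rewrite /mon exprD; ring. Qed.

Lemma monXw i j k n : mon i j k * vw ^+ n = mon i j (k + n).
Proof. by rewrite /mon exprD; ring. Qed.

Lemma mon_split i j k : mon i j k = vu ^+ i * mon 0 j k.
Proof. by rewrite /mon expr0 mul1r mulrA. Qed.

Lemma mon_split2 i j k : mon i j k = (vu ^+ i * vv ^+ j) * mon 0 0 k.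
Proof. by rewrite /mon !expr0 !mul1r. Qed.

(** The radical of the pairing [residue (q * p)]: the largest ideal contained in the kernel of
    [residue]. Showing that the image of a relation is [null] is how the degree map is later seen to
    descend to the Chow ring. *)
Definition null (p : Q3) : Prop := forall q, residue (q * p) = 0.

Lemma nullP p : (forall i j k, residue (mon i j k * p) = 0) -> null p.
Proof.
move=> H q; rewrite [q]mpolyE mulr_suml residue_sum big1 // => m _.
by rewrite -scalerAl residueZ mpolyX_mon H mulr0.
Qed.

Lemma null0 : null 0.
Proof. by move=> q; rewrite mulr0 residue0. Qed.

Lemma nullMl q p : null p -> null (q * p).
Proof. by move=> H q'; rewrite mulrA. Qed.

(** Shaped for the image of a Chow relation: [c] is a sign, [m] the monomial from the atoms, [x1] to
    [x4] the factors from [R1], [R2], the ground set and the hyperplanes, [y] the power of the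
    linear form. One flag factor at most is needed to see nullity. *)
Lemma null_assoc (c m x1 x2 x3 x4 y : Q3) :
  [\/ null (m * y), null (x1 * (m * y)) | null (x2 * (m * y))] ->
  null (c * m * x1 * x2 * x3 * x4 * y).
Proof.
case=> h.
- have -> : c * m * x1 * x2 * x3 * x4 * y = (c * x1 * x2 * x3 * x4) * (m * y)
    by ring.
  exact: nullMl.
- have -> : c * m * x1 * x2 * x3 * x4 * y = (c * x2 * x3 * x4) * (x1 * (m * y))
    by ring.
  exact: nullMl.
have -> : c * m * x1 * x2 * x3 * x4 * y = (c * x1 * x3 * x4) * (x2 * (m * y))
  by ring.
exact: nullMl.
Qed.

Lemma null_mon i j k :
  [|| a <= i, a + 3 <= i + j | a + 6 <= i + j + k]%N -> null (mon i j k).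
Proof.
move=> H; apply: nullP => i' j' k'; rewrite monM residue_mon /top_mon.
by case: eqP => //= e; case: ltnP => //= l1; case: ltnP => //= l2; lia.
Qed.

(** Trading a v for a u keeps the total degree and [i + j], so the two residues can differ only when
    the exponent of u passes from [a - 1] to [a]. In that case [3 <= j] violates [i + j < a + 3],
    and [6 <= j + k] makes the degree exceed [a + 5]. *)
Lemma null_uv j k : (3 <= j)%N || (6 <= j + k)%N ->
  null ((vu - vv) * mon 0 j k).
Proof.
move=> H; apply: nullP => i' j' k'.
have -> : (vu - vv) = mon 1 0 0 - mon 0 1 0 by rewrite /mon; ring.
rewrite mulrBl mulrBr !monM residueB !residue_mon.
apply/eqP; rewrite subr_eq0; apply/eqP; congr (_%:R); congr nat_of_bool.
by rewrite /top_mon; apply/idP/idP; lia.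
Qed.

(** Trading a w for a v can only matter when [i + j] passes from [a + 2] to [a + 3], and then
    [3 <= k] makes the total degree at least [a + 6]. *)
Lemma null_vw k : (3 <= k)%N -> null ((vv - vw) * mon 0 0 k).
Proof.
move=> H; apply: nullP => i' j' k'.
have -> : (vv - vw) = mon 0 1 0 - mon 0 0 1 by rewrite /mon; ring.
rewrite mulrBl mulrBr !monM residueB !residue_mon.
apply/eqP; rewrite subr_eq0; apply/eqP; congr (_%:R); congr nat_of_bool.
by rewrite /top_mon; apply/idP/idP; lia.
Qed.

Lemma null_homog (p : Q3) d : p \is d.-homog -> (a + 6 <= d)%N -> null p.
Proof.
move=> /dhomogP hp le_d; rewrite [p]mpolyE => q.
rewrite mulr_sumr residue_sum big_seq big1 // => m /hp /= dm.
rewrite -scalerAr residueZ mpolyX_mon null_mon ?mulr0 //.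
by rewrite -mdeg3 dm le_d !orbT.
Qed.

(* A top-degree monomial only sees the constant term of its cofactor. *)
Lemma residue_mul_top i j k (q : Q3) : top_mon i j k ->
  residue (q * mon i j k) = q@_0%MM.
Proof.
move=> tm; rewrite [in LHS](mpolyE q) mulr_suml residue_sum.
have F (m : 'X_{1..3}) : residue (q@_m *: 'X_[m] * mon i j k)
    = q@_m * (m == 0%MM)%:R.
  rewrite -scalerAl residueZ mpolyX_mon monM residue_mon; congr (_ * _%:R).
  congr nat_of_bool; rewrite -mdeg_eq0 mdeg3.
  by move: tm; rewrite /top_mon; lia.
rewrite (eq_bigr _ (fun m _ => F m)).
have [s0|n0] := boolP (0%MM \in msupp q); last first.
  rewrite big1_seq ?memN_msupp_eq0 // => m /= ms.
  by case: eqP ms n0 => [-> -> //|]; rewrite mulr0.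
rewrite (bigD1_seq 0%MM) //= eqxx mulr1 big1 ?addr0 // => m /negbTE ->.
by rewrite mulr0.
Qed.

End Residue.

(** * Rank, span and flats of a matroid *)

Section Rank.

Variables (E : finType) (M : matroid E).
Implicit Types A B F : {set E}.

Lemma rk_setU_card A B : M (A :|: B) <= M A + #|B|.
Proof.
apply: leq_trans (leq_trans (leq_addr _ _) (rk_submod M A B)) _.
by rewrite leq_add2l rk_card.
Qed.

(** Induction on the size of [B]: submodularity for [A :|: B :\ e] and [e |: A], whose intersection
    contains [A], bounds the rank of the union. *)
Lemma rk_setU_id A B : {in B, forall e, M (e |: A) = M A} -> M (A :|: B) = M A.
Proof.
elim: {B}_.+1 {-2}B (ltnSn #|B|) => // n IH B ltB hB.
have [->|[e eB]] := set_0Vmem B; first by rewrite setU0.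
have IHe : M (A :|: B :\ e) = M A.
  apply: IH => [|x /setD1P[_ /hB] //].
  by move: ltB; rewrite (cardsD1 e B) eB; lia.
have := rk_submod M (A :|: B :\ e) (e |: A).
have -> : (A :|: B :\ e) :|: (e |: A) = A :|: B.
  apply/setP => x; rewrite !inE; have [->|_] := eqVneq x e.
    by rewrite eB !orbT.
  by do 2?case: (x \in _).
have := rkS M (_ : A \subset (A :|: B :\ e) :&: (e |: A)).
have -> : A \subset (A :|: B :\ e) :&: (e |: A) by rewrite subsetI subsetUl subsetUr.
move=> /(_ isT); rewrite (hB e eB) IHe.
by have := rkS M (subsetUl A B); lia.
Qed.

Lemma sub_span A : A \subset span M A.
Proof. by apply/bigcapsP => F /andP[]. Qed.

Lemma span_flat F : flat M F -> span M F = F.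
Proof. by move=> fF; apply/eqP; rewrite eqEsubset sub_span span_min. Qed.

Lemma rk_span A : M (span M A) = M A.
Proof.
apply/eqP; rewrite eqn_leq (rkS M (sub_span A)) andbT.
(* [C] is the closure in terms of rank; it is a flat containing [A] and of the same rank, hence
   contains the span. *)
pose C := [set e | M (e |: A) == M A].
have sAC : A \subset C.
  by apply/subsetP => e eA; rewrite inE (setUidPr _) // sub1set.
have rkC : M C = M A.
  rewrite -[RHS](@rk_setU_id A C) ?(setUidPr sAC) // => e.
  by rewrite inE => /eqP.
have fC : flat M C.
  apply/forallP => e; apply/implyP; rewrite inE => ne.
  rewrite rkC; apply: (@leq_trans (M (e |: A))); last exact/rkS/setUS.
  by rewrite ltn_neqAle eq_sym ne rkS ?subsetUr.
by rewrite -rkC rkS ?span_min.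
Qed.

Lemma flat_eq F F' : flat M F -> F \subset F' -> M F' <= M F -> F = F'.
Proof.
move=> fF sF le_rk; apply/eqP; rewrite eqEsubset sF /=; apply/subsetP => e eF'.
apply: contraLR le_rk => ne; rewrite -ltnNge.
move/forallP: fF => /(_ e); rewrite ne /= => /leq_trans; apply.
by rewrite rkS // subUset sub1set eF'.
Qed.

Lemma flat_rk_lt F F' : flat M F -> F \proper F' -> M F < M F'.
Proof.
move=> fF /properP[sF [e eF' ne]]; rewrite ltnNge; apply/negP => le_rk.
by rewrite (flat_eq fF sF le_rk) eF' in ne.
Qed.

Lemma indep_subset A B : A \subset B -> M B = #|B| -> M A = #|A|.
Proof.
move=> sAB iB; apply/eqP; rewrite eqn_leq rk_card /=.
have eB : A :|: B :\: A = B by rewrite -{2}(setID B A) (setIidPr sAB).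
have := rk_setU_card A (B :\: A); rewrite eB iB.
by have := cardsID A B; rewrite (setIidPr sAB); lia.
Qed.

End Rank.

(** * The Chow ideal and the substitution of values for its variables *)

Section ChowIdeal.

Local Open Scope ring_scope.

Variables (E : finType) (M : matroid E) (G : {set {set E}}).
Local Notation P := {mpoly rat[#|G|]}.
Local Notation elt i := (@enum_val _ (mem G) i).
Local Notation ideal := (@chow_ideal E M G).

Lemma chow_ideal0 : ideal 0.
Proof.
exists (fun _ _ => 0); rewrite big1 // => S _; rewrite big1 // => g _.
by rewrite mul0r.
Qed.

Lemma chow_idealD (p q : P) : ideal p -> ideal q -> ideal (p + q).
Proof.
move=> [c ->] [c' ->]; exists (fun S g => c S g + c' S g).
rewrite -big_split; apply: eq_bigr => S _; rewrite -big_split.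
by apply: eq_bigr => g _; rewrite mulrDl.
Qed.

Lemma chow_idealM (q p : P) : ideal p -> ideal (q * p).
Proof.
move=> [c ->]; exists (fun S g => q * c S g); rewrite mulr_sumr.
by apply: eq_bigr => S _; rewrite mulr_sumr; apply: eq_bigr => g _; rewrite mulrA.
Qed.

Lemma chow_idealZ (c : rat) (p : P) : ideal p -> ideal (c *: p).
Proof. by rewrite -mul_mpolyC; apply: chow_idealM. Qed.

Lemma chow_idealN (p : P) : ideal p -> ideal (- p).
Proof. by rewrite -scaleN1r; apply: chow_idealZ. Qed.

Lemma chow_idealB (p q : P) : ideal p -> ideal q -> ideal (p - q).
Proof. by move=> Ip Iq; apply/chow_idealD/chow_idealN. Qed.

Lemma chow_ideal_gen S g : ideal (chow_rel M S g).
Proof.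
exists (fun S' g' => ((S' == S) && (g' == g))%:R).
rewrite (bigD1 S) //= (bigD1 g) //= !eqxx mul1r big1 ?addr0 => [|g' /negbTE->].
  by rewrite big1 ?addr0 // => S' /negbTE-> /=; rewrite big1 // => g' _; rewrite mul0r.
by rewrite andbF mul0r.
Qed.

(* [chow_rel] with the subsets indexed by [G] itself instead of its
   enumeration, and the variables replaced by the values of [F]. *)
Definition set_rel (A : comNzRingType) (F : {set E} -> A) (S : {set {set E}})
    (K : {set E}) : A :=
  (\prod_(H in S) F H) * (\sum_(H in G | K \subset H) F H)
    ^+ (M K - M (span M (\bigcup_(H in S | H \proper K) H))).

(** A sum over indices avoids carrying a proof that [H] belongs to [G]: it has one term if [H] is in
    [G] and is 0 otherwise. *)
Definition xvar (H : {set E}) : P := \sum_(i : 'I_#|G| | elt i == H) 'X_i.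

Lemma xvar_elt i : xvar (elt i) = 'X_i.
Proof.
rewrite /xvar (bigD1 i) //= big1 ?addr0 // => j /andP[/eqP/enum_val_inj->].
by rewrite eqxx.
Qed.

Definition ev (F : {set E} -> {mpoly rat[3]}) : P -> {mpoly rat[3]} :=
  mmap (@mpolyC 3 rat) (fun i => F (elt i)).

Lemma ev_xvar F H : H \in G -> ev F (xvar H) = F H.
Proof.
move=> HG; rewrite -{1}(enum_rankK_in HG HG) xvar_elt /ev mmapX mmap1U.
by rewrite enum_rankK_in.
Qed.

Section Transfer.

Variables (A : comNzRingType) (F : {set E} -> A) (S : {set 'I_#|G|}) (g : 'I_#|G|).

Lemma set_relE : set_rel F [set elt i | i in S] (elt g) =
  (\prod_(i in S) F (elt i))
  * (\sum_(h : 'I_#|G| | elt g \subset elt h) F (elt h))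
      ^+ (M (elt g) - M (sup_below M S g)).
Proof.
rewrite /set_rel big_imset /=; last by move=> i j _ _ /enum_val_inj.
rewrite /sup_below big_imset_cond /=; last by move=> i j _ _ /enum_val_inj.
by rewrite big_enum_val_cond.
Qed.

End Transfer.

Lemma chow_relE S g : chow_rel M S g = set_rel xvar [set elt i | i in S] (elt g).
Proof.
rewrite set_relE /chow_rel; congr (_ * _ ^+ _); apply: eq_bigr => i _;
by rewrite xvar_elt.
Qed.

Lemma ev_chow_rel F S g :
  ev F (chow_rel M S g) = set_rel F [set elt i | i in S] (elt g).
Proof.
have evX i : ev F 'X_i = F (elt i) by rewrite /ev mmapX mmap1U.
rewrite set_relE /chow_rel /ev rmorphM rmorphXn rmorph_prod rmorph_sum /=.
by congr (_ * _ ^+ _); apply: eq_bigr => i _; rewrite -evX.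
Qed.

Lemma set_rel_ideal (S : {set {set E}}) K : S \subset G -> K \in G -> ideal (set_rel xvar S K).
Proof.
move=> sSG KG; pose S' := [set i | elt i \in S].
have -> : S = [set elt i | i in S'].
  apply/setP => H; apply/idP/imsetP => [HS|[i]]; last by rewrite inE => iS ->.
  have HG := subsetP sSG H HS; exists (enum_rank_in HG H).
    by rewrite inE enum_rankK_in.
  by rewrite enum_rankK_in.
by rewrite -(enum_rankK_in KG KG) -chow_relE; apply: chow_ideal_gen.
Qed.

(** Every nonconstant monomial acquires a factor without constant term. The constant term of
    [ev F q] is thus the same for all substitutions used, which is what makes the flag and
    hyperplane contributions to the degree map cancel. *)
Lemma mcoeff0_ev F q : {in G, forall H, (F H)@_0%MM = 0} ->
  (ev F q)@_0%MM = q@_0%MM.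
Proof.
move=> F0; rewrite /ev /mmap rmorph_sum /=.
have eqF (m : 'X_{1..#|G|}) : ((q@_m)%:MP_[3] *
     mmap1 (fun i => F (elt i)) m)@_0%MM = q@_m * (m == 0%MM)%:R.
  rewrite mcoeffCM; congr (_ * _).
  have [->|/eqP] := eqVneq m 0%MM; first by rewrite mmap11 mcoeff1 eqxx.
  move/eqP; rewrite -mdeg_eq0 mdegE => nz.
  have [i mi] : exists i, m i != 0%N.
    apply/existsP; apply: contraNT nz => /existsPn h.
    by rewrite big1 // => i _; apply/eqP; move: (h i); rewrite negbK.
  rewrite /mmap1 (bigD1 i) //= -(prednK (n := m i)) ?lt0n // exprS -mulrA.
  by rewrite rmorphM /= F0 ?mul0r // enum_valP.
rewrite (eq_bigr _ (fun m _ => eqF m)).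
have [s0|n0] := boolP (0%MM \in msupp q); last first.
  rewrite big1_seq ?memN_msupp_eq0 // => m /= ms.
  by case: eqP ms n0 => [-> -> //|]; rewrite mulr0.
rewrite (bigD1_seq 0%MM) //= eqxx mulr1 big1 ?addr0 // => m /negbTE ->.
by rewrite mulr0.
Qed.

End ChowIdeal.

(** * The building set made of atoms, a flag and hyperplanes *)

Section FlagAndHyperplanes.

Variables (E : finType) (M : matroid E) (G : {set {set E}}).
Variables (R1 R2 : {set E}) (N : nat) (P : 'I_N -> {set E}) (a : nat).

Hypotheses (a_gt1 : 1 < a) (loopM : loopless M).
Hypothesis flat_set1 : forall e, flat M [set e].
Hypotheses (flatR1 : flat M R1) (flatR2 : flat M R2).
Hypothesis flatP : forall f, flat M (P f).
Hypotheses (rkR1 : M R1 = a) (rkR2 : M R2 = a + 3) (rkT : M setT = a + 6).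
Hypothesis rkP : forall f, M (P f) = a + 5.
Hypotheses (sR12 : R1 \subset R2) (R1_nsub_hyp : forall f, ~~ (R1 \subset P f)).
Hypothesis injP : injective P.
Hypothesis defG :
  G = [set [set e] | e : E] :|: [set R1; R2; setT] :|: [set P f | f : 'I_N].

Local Ltac rlia := move: a_gt1; clear; lia.

Lemma rk_set1 e : M [set e] = 1.
Proof.
apply/eqP; rewrite eqn_leq -{1}(cards1 e) rk_card /=.
by have /forallP/(_ e) := loopM; rewrite inE setU0 rk0.
Qed.

Lemma R2_nsub_hyp f : ~~ (R2 \subset P f).
Proof. by apply: contra (R1_nsub_hyp f); apply: subset_trans. Qed.

Lemma T_nsub_hyp f : ~~ (setT \subset P f).
Proof. by apply: contra (R1_nsub_hyp f); apply: subset_trans (subsetT _). Qed.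

Lemma subset_rk (A B : {set E}) : M B < M A -> ~~ (A \subset B).
Proof. by apply: contraTN => /(rkS M); rewrite -leqNgt. Qed.

Lemma neq_rk (A B : {set E}) : M A != M B -> A == B = false.
Proof. by move=> neq; apply/eqP => eqAB; rewrite eqAB eqxx in neq. Qed.

Lemma mem_set1 e : [set e] \in G.
Proof. by rewrite defG !inE imset_f. Qed.
Lemma mem_R1 : R1 \in G. Proof. by rewrite defG !inE eqxx ?orbT. Qed.
Lemma mem_R2 : R2 \in G. Proof. by rewrite defG !inE eqxx ?orbT. Qed.
Lemma mem_T : setT \in G. Proof. by rewrite defG !inE eqxx ?orbT. Qed.
Lemma mem_hyp f : P f \in G. Proof. by rewrite defG inE imset_f ?orbT. Qed.

Variant G_spec : {set E} -> Prop :=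
  | InSingle e : G_spec [set e]
  | InR1 : G_spec R1
  | InR2 : G_spec R2
  | InT : G_spec setT
  | InHyp f : G_spec (P f).

Lemma mem_GP H : H \in G -> G_spec H.
Proof.
rewrite defG !inE -!orbA => /or4P[/imsetP[e _ ->]|/eqP->|/eqP->|].
- exact: InSingle.
- exact: InR1.
- exact: InR2.
by case/orP => [/eqP->|/imsetP[f _ ->]]; [exact: InT | exact: InHyp].
Qed.

Lemma mem_flat H : H \in G -> flat M H.
Proof. by case/mem_GP => // *; rewrite ?flatT. Qed.

Lemma G_neq0 H : H \in G -> H != set0.
Proof.
case/mem_GP => [e|||| f]; rewrite neq_rk // rk0 ?rk_set1 ?rkR1 ?rkR2 ?rkT ?rkP; rlia.
Qed.

Section BigG.

Variables (T : Type) (idx : T) (op : Monoid.com_law idx).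

(** The five kinds of members have the distinct ranks [1], [a], [a + 3], [a + 6] and [a + 5], so the
    three unions defining [G] are disjoint. A general commutative law serves both sums and
    products. *)
Lemma big_G (C : pred {set E}) (F : {set E} -> T) :
  \big[op/idx]_(H in G | C H) F H =
  op (op (op (op (\big[op/idx]_(e | C [set e]) F [set e])
    (if C R1 then F R1 else idx)) (if C R2 then F R2 else idx))
    (if C setT then F setT else idx)) (\big[op/idx]_(f | C (P f)) F (P f)).
Proof.
have bigS (A B : {set {set E}}) (F' : {set E} -> T) :
    (forall H, H \in A -> H \in B -> False) ->
    \big[op/idx]_(H in A :|: B) F' H =
    op (\big[op/idx]_(H in A) F' H) (\big[op/idx]_(H in B) F' H).
  move=> dis; rewrite -bigU /=; first by apply: eq_bigl => H; rewrite !inE.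
  by rewrite disjoint_subset; apply/subsetP => H HA; apply/negP => /(dis _ HA).
rewrite big_mkcondr /= defG bigS; last first.
  move=> _ /[swap] /imsetP[f _ ->] /setUP[/imsetP[e _]|].
    by move=> /(congr1 M); rewrite rk_set1 rkP; rlia.
  rewrite !inE => /orP[/orP[]|] /eqP /(congr1 M);
  by rewrite rkP ?rkR1 ?rkR2 ?rkT; rlia.
rewrite bigS; last first.
  move=> H /imsetP[e _ ->]; rewrite !inE => /orP[/orP[]|] /eqP /(congr1 M);
  by rewrite rk_set1 ?rkR1 ?rkR2 ?rkT; rlia.
rewrite bigS; last first.
  move=> H; rewrite !inE => /orP[] /eqP -> /eqP /(congr1 M);
  by rewrite ?rkR1 ?rkR2 ?rkT; rlia.
rewrite bigS; last first.
  by move=> H; rewrite !inE => /eqP -> /eqP /(congr1 M); rewrite ?rkR1 ?rkR2; rlia.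
rewrite big_imset /=; last by move=> x y _ _ /set1_inj.
rewrite big_imset /=; last by move=> x y _ _ /injP.
rewrite !big_set1 Monoid.mulmA.
rewrite -!big_mkcond /= !Monoid.mulmA.
by congr (op (op (op (op _ _) _) _) _); apply: eq_bigl.
Qed.

End BigG.

Local Open Scope ring_scope.

Local Notation Q3 := {mpoly rat[3]}.

(** * Values of the variables on the flag part and on each hyperplane part *)

Definition ylin (e : E) : Q3 :=
  if e \in R1 then vu else if e \in R2 then vv else vw.

(** Inverts the substitution [u = x_R1 + x_R2 + x_E], [v = x_R2 + x_E], [w = x_E]. An atom receives
    minus the sum of the flag variables above it, which telescopes to [ylin e]; the hyperplanes are
    sent to 0. *)
Definition flag_val (H : {set E}) : Q3 :=
  if H == R1 then vu - vv else if H == R2 then vv - vw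
  else if H == setT then vw
  else if [pick e in H] is Some e then if #|H| == 1%N then - ylin e else 0
  else 0.

(** The part of the ring where only [x_(P f)] survives, with [vw] standing for that variable. The
    atoms below [P f] take the value [- vw] so that their linear relations still hold. *)
Definition hyp_val (f : 'I_N) (H : {set E}) : Q3 :=
  if H == P f then vw
  else if (#|H| == 1%N) && (H \subset P f) then - vw else 0.

Lemma card_rk_gt1 (H : {set E}) : (1 < M H)%N -> #|H| == 1%N = false.
Proof. by move=> h; apply/negbTE; have := rk_card M H; lia. Qed.

Lemma flag_val1 e : flag_val [set e] = - ylin e.
Proof.
rewrite /flag_val !neq_rk ?rk_set1 ?rkR1 ?rkR2 ?rkT; try rlia.
case: pickP => [x|/(_ e)]; last by rewrite inE eqxx.
by rewrite inE => /eqP->; rewrite cards1.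
Qed.

Lemma flag_valR1 : flag_val R1 = vu - vv.
Proof. by rewrite /flag_val eqxx. Qed.

Lemma flag_valR2 : flag_val R2 = vv - vw.
Proof. by rewrite /flag_val eqxx neq_rk // rkR1 rkR2; rlia. Qed.

Lemma flag_valT : flag_val setT = vw.
Proof. by rewrite /flag_val eqxx !neq_rk // ?rkR1 ?rkR2 rkT; rlia. Qed.

Lemma flag_valP f : flag_val (P f) = 0.
Proof.
rewrite /flag_val !neq_rk // ?rkR1 ?rkR2 ?rkT ?rkP; try rlia.
by rewrite card_rk_gt1 ?rkP; [case: pickP | rlia].
Qed.

Lemma hyp_val1 f e : hyp_val f [set e] = if e \in P f then - vw else 0.
Proof. by rewrite /hyp_val neq_rk ?rk_set1 ?rkP ?cards1 ?sub1set //; rlia. Qed.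

Lemma hyp_valR1 f : hyp_val f R1 = 0.
Proof. by rewrite /hyp_val neq_rk ?card_rk_gt1 // ?rkR1 ?rkP; rlia. Qed.

Lemma hyp_valR2 f : hyp_val f R2 = 0.
Proof. by rewrite /hyp_val neq_rk ?card_rk_gt1 // ?rkR2 ?rkP; rlia. Qed.

Lemma hyp_valT f : hyp_val f setT = 0.
Proof. by rewrite /hyp_val neq_rk ?card_rk_gt1 // ?rkT ?rkP; rlia. Qed.

Lemma hyp_valP f f' : hyp_val f (P f') = if f' == f then vw else 0.
Proof.
rewrite /hyp_val (inj_eq injP) card_rk_gt1 ?rkP //; last by rlia.
Qed.

Lemma sub_set1F (K : {set E}) e : (1 < M K)%N -> K \subset [set e] = false.
Proof. by move=> h; apply/negbTE/subset_rk; rewrite rk_set1. Qed.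

Lemma sub_hyp f f' : P f \subset P f' = (f == f').
Proof.
apply/idP/eqP => [sP|->//]; apply: injP; apply: flat_eq => //.
by rewrite !rkP.
Qed.

Lemma sumG1 (V : nmodType) (F : {set E} -> V) e :
  \sum_(H in G | [set e] \subset H) F H = F [set e]
    + (if e \in R1 then F R1 else 0) + (if e \in R2 then F R2 else 0)
    + F setT + \sum_(f | e \in P f) F (P f).
Proof.
rewrite big_G !sub1set inE /=; congr (_ + _ + _ + _ + _).
  by rewrite (big_pred1 e) // => x; rewrite sub1set inE eq_sym.
by apply: eq_bigl => f; rewrite sub1set.
Qed.

Lemma sumG_gt1 (V : nmodType) (F : {set E} -> V) (K : {set E}) : (1 < M K)%N ->
  \sum_(H in G | K \subset H) F H = 
    (if K \subset R1 then F R1 else 0) + (if K \subset R2 then F R2 else 0)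
    + F setT + \sum_(f | K \subset P f) F (P f).
Proof.
move=> K_gt1; rewrite big_G /= subsetT big_pred0 ?add0r // => e.
exact: sub_set1F.
Qed.

Lemma flag_sum1 e : \sum_(H in G | [set e] \subset H) flag_val H = 0.
Proof.
rewrite sumG1 flag_val1 flag_valR1 flag_valR2 flag_valT.
rewrite big1 => [|f _]; last by rewrite flag_valP.
rewrite /ylin; have := subsetP sR12 e.
by case: (e \in R1) => [->//|_]; [ring | case: (e \in R2); ring].
Qed.

Lemma flag_sumR1 : \sum_(H in G | R1 \subset H) flag_val H = vu.
Proof.
rewrite sumG_gt1 ?rkR1 // subxx sR12 flag_valR1 flag_valR2 flag_valT.
by rewrite big1 => [|f _]; [ring | rewrite flag_valP].
Qed.

Lemma flag_sumR2 : \sum_(H in G | R2 \subset H) flag_val H = vv.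
Proof.
rewrite sumG_gt1 ?rkR2 ?subxx; last by rlia.
rewrite (negbTE (subset_rk _)) ?rkR1 ?rkR2; last by rlia.
rewrite flag_valR2 flag_valT.
by rewrite big1 => [|f _]; [ring | rewrite flag_valP].
Qed.

Lemma flag_sumT : \sum_(H in G | setT \subset H) flag_val H = vw.
Proof.
rewrite sumG_gt1 ?rkT; last by rlia.
rewrite !(negbTE (subset_rk _)) ?rkR1 ?rkR2 ?rkT; try rlia.
by rewrite flag_valT big1 => [|f _]; [ring | rewrite flag_valP].
Qed.

Lemma flag_sumP f : \sum_(H in G | P f \subset H) flag_val H = vw.
Proof.
rewrite sumG_gt1 ?rkP; last by rlia.
rewrite !(negbTE (subset_rk _)) ?rkR1 ?rkR2 ?rkP; try rlia.
by rewrite flag_valT big1 => [|f' _]; [ring | rewrite flag_valP].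
Qed.

Lemma hyp_sum f K : K \in G ->
  \sum_(H in G | K \subset H) hyp_val f H = if K == P f then vw else 0.
Proof.
case/mem_GP => [e|||| f'].
- rewrite sumG1 hyp_val1 hyp_valR1 hyp_valR2 hyp_valT !if_same !addr0.
  rewrite neq_rk ?rk_set1 ?rkP; last by rlia.
  rewrite (eq_bigr (fun f' => if f' == f then vw else 0)); last first.
    by move=> f' _; rewrite hyp_valP.
  case: (boolP (e \in P f)) => ef; last first.
    rewrite add0r big1 // => f'; case: eqP => // ->.
    by rewrite (negbTE ef).
  rewrite (bigD1 f) //= eqxx big1 => [|f' /andP[_ /negbTE->//]].
  by ring.
- rewrite sumG_gt1 ?rkR1 // hyp_valR1 hyp_valR2 hyp_valT !if_same !addr0.
  rewrite big_pred0 ?neq_rk ?addr0 ?rkR1 ?rkP // ?addr0; try rlia.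
  by move=> f'; apply/negbTE.
- rewrite sumG_gt1 ?rkR2; last by rlia.
  rewrite hyp_valR1 hyp_valR2 hyp_valT !if_same !addr0.
  rewrite big_pred0 ?neq_rk ?addr0 ?rkR2 ?rkP //; try rlia.
  by move=> f'; apply/negbTE/R2_nsub_hyp.
- rewrite sumG_gt1 ?rkT; last by rlia.
  rewrite hyp_valR1 hyp_valR2 hyp_valT !if_same !addr0.
  rewrite big_pred0 ?neq_rk ?addr0 ?rkT ?rkP //; try rlia.
  by move=> f'; apply/negbTE/T_nsub_hyp.
- rewrite sumG_gt1 ?rkP; last by rlia.
  rewrite hyp_valR1 hyp_valR2 hyp_valT !if_same !addr0 add0r.
  rewrite (big_pred1 f') => [|g]; last by rewrite sub_hyp eq_sym.
  by rewrite hyp_valP (inj_eq injP).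
Qed.

(** * Vanishing of the Chow relations under these substitutions *)

Definition atoms_of (S : {set {set E}}) : {set E} := [set e | [set e] \in S].
Definition below_in (S : {set {set E}}) (K : {set E}) : {set E} :=
  \bigcup_(H in S | H \proper K) H.

Lemma prod_ylin (A : {set E}) : \prod_(e in A) ylin e =
  mon #|A :&: R1| #|(A :&: R2) :\: R1| #|A :\: R2|.
Proof.
rewrite (bigID (mem R1)) /= /mon -mulrA; congr (_ * _).
  rewrite (eq_bigr (fun=> vu)); last by move=> e /andP[_ h]; rewrite /ylin h.
  by rewrite prodr_const; congr (_ ^+ _); apply: eq_card => e; rewrite !inE.
rewrite (bigID (mem R2)) /=; congr (_ * _).
  rewrite (eq_bigr (fun=> vv)); last first.
    by move=> e /andP[/andP[_ /negbTE h] h']; rewrite /ylin h h'.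
  rewrite prodr_const; congr (_ ^+ _); apply: eq_card => e; rewrite !inE.
  by rewrite unfold_in; do !case: (e \in _).
rewrite (eq_bigr (fun=> vw)); last first.
  by move=> e /andP[/andP[_ /negbTE h] /negbTE h']; rewrite /ylin h h'.
rewrite prodr_const; congr (_ ^+ _); apply: eq_card => e; rewrite !inE unfold_in.
by have := subsetP sR12 e; do !case: (e \in _) => //; move=> /(_ isT).
Qed.

(** The trailing product of zeros is 1 when [S] contains no hyperplane and 0 otherwise. *)
Lemma prod_flag (S : {set {set E}}) : S \subset G ->
  \prod_(H in S) flag_val H =
  (-1) ^+ #|atoms_of S| * mon #|atoms_of S :&: R1| #|(atoms_of S :&: R2) :\: R1| #|atoms_of S :\: R2|
  * (if R1 \in S then vu - vv else 1) * (if R2 \in S then vv - vw else 1)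
  * (if setT \in S then vw else 1) * \prod_(f | P f \in S) 0.
Proof.
move=> sSG; rewrite (eq_bigl (fun H => (H \in G) && (H \in S))); last first.
  by move=> H; rewrite andb_idl // => /(subsetP sSG).
rewrite big_G /=.
have -> : \prod_(e | [set e] \in S) flag_val [set e]
    = (-1) ^+ #|atoms_of S| * \prod_(e in atoms_of S) ylin e.
  rewrite -prodrN; apply: eq_big => e; first by rewrite inE.
  by rewrite flag_val1.
have -> : \prod_(f | P f \in S) flag_val (P f) = \prod_(f | P f \in S) 0.
  by apply: eq_bigr => f _; rewrite flag_valP.
by rewrite prod_ylin flag_valR1 flag_valR2 flag_valT.
Qed.

Implicit Types (S : {set {set E}}) (K H B A : {set E}).

(** Bounds the exponent of a relation from below: beyond [B], each atom of [S] lowers it by at most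
    one, and that same atom contributes a linear factor to the product. *)
Lemma rk_below_in S K B : below_in S K \subset B :|: (atoms_of S :&: K) ->
  (M (span M (below_in S K)) <= M B + #|(atoms_of S :&: K) :\: B|)%N.
Proof.
move=> sB; rewrite rk_span (leq_trans (rkS M sB)) //.
apply: leq_trans (rk_setU_card _ _ _); apply: rkS; apply/subsetP => e.
by rewrite !inE; case: (e \in B).
Qed.

Lemma below_in_sub S K B : S \subset G ->
  (forall H, H \in S -> H \proper K -> (1 < M H)%N -> H \subset B) ->
  below_in S K \subset B :|: (atoms_of S :&: K).
Proof.
move=> sSG hB; apply/bigcupsP => H /andP[HS HK].
have nonatom : (1 < M H)%N -> H \subset B :|: (atoms_of S :&: K).
  by move=> h; rewrite (subset_trans (hB H HS HK h)) ?subsetUl.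
have gH := mem_GP (subsetP sSG H HS); case: H / gH HS HK nonatom => [e eS /proper_sub eK _||||f] *.
- rewrite sub1set; move: eK; rewrite sub1set !inE eS => ->.
  by rewrite orbT.
all: match goal with h : is_true (1 < _)%N -> _ |- _ => apply: h end.
- by rewrite rkR1.
- by rewrite rkR2; rlia.
- by rewrite rkT; rlia.
- by rewrite rkP; rlia.
Qed.

Lemma below_in_set1 S e : S \subset G -> below_in S [set e] = set0.
Proof.
move=> sSG; rewrite /below_in big1 // => H /andP[HS].
rewrite properEneq subset1 => /andP[/negbTE-> /=].
by rewrite (negbTE (G_neq0 (subsetP sSG _ HS))).
Qed.

Lemma proper_rk (A B : {set E}) : A \proper B -> ~~ (M B < M A)%N.
Proof. by move=> /proper_sub /(rkS M); rewrite -leqNgt. Qed.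

Lemma G_proper_R1 H : H \in G -> H \proper R1 -> (M H <= 1)%N.
Proof.
case/mem_GP => [e|||| f]; rewrite ?rk_set1 ?properxx // => /proper_rk;
by rewrite rkR1 ?rkR2 ?rkT ?rkP; rlia.
Qed.

Lemma G_proper_R2 H : H \in G -> H \proper R2 -> (M H <= 1)%N \/ H = R1.
Proof.
case/mem_GP => [e|||| f]; rewrite ?rk_set1 ?properxx; [by left|by right|by [] | |];
by move/proper_rk; rewrite rkR2 ?rkT ?rkP; rlia.
Qed.

(* The pairs [(S, K)] whose relation has degree exactly [a + 5] in both the flag
   part and the part of the hyperplane [P f], where the two contributions to
   the degree map have to cancel. *)
Definition exceptional (f : 'I_N) (S : {set {set E}}) (K : {set E}) : bool :=
  [&& K == P f, S == [set [set e] | e in atoms_of S], atoms_of S \subset P f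
    & M (atoms_of S) == #|atoms_of S|].

Lemma null_flag_set1 S e : S \subset G ->
  null a (set_rel M G flag_val S [set e]).
Proof.
move=> sSG; rewrite /set_rel flag_sum1 -/(below_in _ _) below_in_set1 //.
by rewrite rk_span rk0 rk_set1 subn0 expr1 mulr0; apply: null0.
Qed.

(** Only atoms of [G] lie properly below [R1], so each unit lost in the exponent of u is restored by
    the value of an atom in [R1], and [u^a] divides the result. *)
Lemma null_flag_R1 S : S \subset G -> null a (set_rel M G flag_val S R1).
Proof.
move=> sSG; rewrite /set_rel flag_sumR1 -/(below_in _ _) prod_flag //.
set r := M (span M _).
have le_r : (r <= #|atoms_of S :&: R1|)%N.
  have := @rk_below_in S R1 set0; rewrite rk0 setD0; apply.
  apply: below_in_sub => // H HS HR1.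
  by rewrite ltnNge G_proper_R1 // (subsetP sSG).
apply: null_assoc; apply: Or31; rewrite monXu; apply: null_mon.
by apply/or3P; apply: Or31; rewrite rkR1; move: le_r; clear; lia.
Qed.

(** If [R1] is in [S], its factor [vu - vv] meets a power of v of exponent at least 3; otherwise the
    exponents of u and v together reach [a + 3]. *)
Lemma null_flag_R2 S : S \subset G -> null a (set_rel M G flag_val S R2).
Proof.
move=> sSG; rewrite /set_rel flag_sumR2 -/(below_in _ _) prod_flag //.
set A := atoms_of S; set r := M (span M _).
have eA : #|A :&: R2| = (#|A :&: R1| + #|(A :&: R2) :\: R1|)%N.
  by rewrite -(cardsID R1 (A :&: R2)) -setIA (setIidPr sR12).
have [SR1|nSR1] := boolP (R1 \in S).
  have le_r : (r <= a + #|(A :&: R2) :\: R1|)%N.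
    rewrite -rkR1; apply: rk_below_in; apply: below_in_sub => // H HS.
    case/(G_proper_R2 (subsetP sSG H HS)) => [le1|->]; last by rewrite subxx.
    by rewrite ltnNge le1.
  apply: null_assoc; apply: Or32; rewrite monXv mon_split mulrCA.
  apply/nullMl/null_uv; apply/orP; left; rewrite rkR2.
  by move: le_r; clear; lia.
have le_r : (r <= #|A :&: R2|)%N.
  have := @rk_below_in S R2 set0; rewrite rk0 setD0; apply.
  apply: below_in_sub => // H HS.
  case/(G_proper_R2 (subsetP sSG H HS)) => [le1|eH]; first by rewrite ltnNge le1.
  by rewrite -eH HS in nSR1.
apply: null_assoc; apply: Or31; rewrite monXv; apply: null_mon.
by apply/or3P; apply: Or32; rewrite rkR2; move: le_r eA; clear; lia.
Qed.

Lemma null_flag_P_in S K f : S \subset G -> P f \in S ->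
  null a (set_rel M G flag_val S K).
Proof.
move=> sSG PS; rewrite /set_rel prod_flag // (bigD1 f) //= mul0r mulr0 mul0r.
exact: null0.
Qed.

Lemma cards_split3 A : #|A| = (#|A :&: R1| + #|(A :&: R2) :\: R1| + #|A :\: R2|)%N.
Proof.
rewrite -(cardsID R2 A) -(cardsID R1 (A :&: R2)) -setIA (setIidPr sR12).
by [].
Qed.

(** The cases follow the largest proper flag member in [S]. For [R2], the factor [vv - vw] meets
    [w^3]; for [R1], the factor [vu - vv] meets degree at least 6 in v and w; for none, the total
    degree is at least [a + 6]. *)
Lemma null_flag_T S : S \subset G -> (forall f, P f \notin S) ->
  null a (set_rel M G flag_val S setT).
Proof.
move=> sSG nPS; rewrite /set_rel flag_sumT -/(below_in _ _) prod_flag //.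
have eA := cards_split3 (atoms_of S).
set A := atoms_of S in eA *; set r := M (span M _).
have [SR2|nSR2] := boolP (R2 \in S).
  have le_r : (r <= a + 3 + #|A :\: R2|)%N.
    rewrite -rkR2 -[A in A :\: _]setIT.
    apply: rk_below_in; apply: below_in_sub => // H HS.
    have gH := mem_GP (subsetP sSG H HS); case: H / gH HS => [e _|||_|f] //; rewrite ?rk_set1 ?properxx //.
    by rewrite (negbTE (nPS f)).
  apply: null_assoc; apply: Or33; rewrite monXw mon_split2 mulrCA.
  by apply/nullMl/null_vw; rewrite rkT; move: le_r; clear; lia.
have [SR1|nSR1] := boolP (R1 \in S).
  have le_r : (r <= a + #|A :\: R1|)%N.
    rewrite -rkR1 -[A in A :\: _]setIT.
    apply: rk_below_in; apply: below_in_sub => // H HS.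
    have gH := mem_GP (subsetP sSG H HS); case: H / gH HS nSR2 => [e _||-> //|_|f] //; rewrite ?rk_set1 ?properxx //.
    by rewrite (negbTE (nPS f)).
  have : #|A :\: R1| = (#|A| - #|A :&: R1|)%N by rewrite cardsD.
  move=> eD; apply: null_assoc; apply: Or32; rewrite monXw mon_split mulrCA.
  apply/nullMl/null_uv; apply/orP; right; rewrite rkT.
  by move: le_r eD eA; clear; lia.
have le_r : (r <= #|A|)%N.
  have := @rk_below_in S setT set0; rewrite rk0 setD0 => h.
  rewrite -(setIT A); apply: h.
  apply: below_in_sub => // H HS.
  have gH := mem_GP (subsetP sSG H HS); case: H / gH HS nSR1 nSR2 => [e _|-> //|-> //|_|f] //; rewrite ?rk_set1 ?properxx //.
  by rewrite (negbTE (nPS f)).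
apply: null_assoc; apply: Or31; rewrite monXw; apply: null_mon.
by apply/or3P; apply: Or33; rewrite rkT; move: le_r eA; clear; lia.
Qed.

Lemma exceptional_below S f : S = [set [set e] | e in atoms_of S] ->
  atoms_of S \subset P f -> below_in S (P f) = atoms_of S.
Proof.
move=> eS sA; apply/eqP; rewrite eqEsubset; apply/andP; split.
  rewrite {1}eS; apply/bigcupsP => _ /andP[/imsetP[e eA ->] _].
  by rewrite sub1set.
apply/subsetP => e eA; apply/bigcupP; exists [set e]; rewrite ?inE //.
rewrite eS imset_f //= properEneq sub1set (subsetP sA _ eA) andbT.
by rewrite neq_rk // rk_set1 rkP; rlia.
Qed.

Lemma notin_imset_atoms S H : (1 < M H)%N -> S = [set [set e] | e in atoms_of S] ->
  H \notin S.
Proof.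
by move=> h ->; apply/imsetP => -[e _ eH]; rewrite eH rk_set1 in h.
Qed.

(** For [K] equal to [R1] or [R2], the atoms of [S] in [K] are independent and lie in the proper
    subflat [K :&: P f], so there are fewer than [M K] of them. These strict inequalities are
    exactly the bounds in [top_mon]. *)
Lemma flag_rel_exceptional f S : exceptional f S (P f) ->
  exists i j k, top_mon a i j k /\
    set_rel M G flag_val S (P f) = (-1) ^+ #|atoms_of S| * mon i j k.
Proof.
case/and4P => _ /eqP eS sA /eqP iA.
have sSG : S \subset G.
  by rewrite eS; apply/subsetP => _ /imsetP[e _ ->]; apply: mem_set1.
have lt_rk K : flat M K -> ~~ (K \subset P f) -> (#|atoms_of S :&: K| < M K)%N.
  move=> fK nK; rewrite -(indep_subset (subsetIl _ _) iA).
  apply: leq_ltn_trans (rkS M (setSI K sA)) _.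
  apply: flat_rk_lt; first exact: flatI.
  by rewrite properE subsetIr subsetI negb_and nK.
have lt1 := lt_rk _ flatR1 (R1_nsub_hyp f); rewrite rkR1 in lt1.
have lt2 := lt_rk _ flatR2 (R2_nsub_hyp f); rewrite rkR2 in lt2.
have := cards_split3 (atoms_of S) => e3.
have e2 : #|atoms_of S :&: R2| = (#|atoms_of S :&: R1| + #|(atoms_of S :&: R2) :\: R1|)%N.
  by rewrite -(cardsID R1 (atoms_of S :&: R2)) -setIA (setIidPr sR12).
have leA : (#|atoms_of S| <= a + 5)%N by rewrite -iA -(rkP f) rkS.
rewrite /set_rel flag_sumP -/(below_in _ _) exceptional_below // prod_flag //.
rewrite !(negbTE (notin_imset_atoms _ eS)) ?rkR1 ?rkR2 ?rkT; try rlia.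
rewrite big_pred0 => [|f']; last first.
  by apply/negbTE/(notin_imset_atoms _ eS); rewrite rkP; rlia.
rewrite !mulr1 -mulrA monXw rk_span iA rkP.
do 3!eexists; split; last by [].
by rewrite /top_mon; apply/and3P; split; move: e3 e2 leA lt1 lt2; clear; lia.
Qed.

Lemma mon_homog i j k : mon i j k \is (i + j + k).-homog.
Proof.
rewrite monE dhomogX /=; apply/eqP; rewrite [LHS]mdeg3.
by case: (mnm3E i j k) => -> -> ->.
Qed.

(** The relation has degree [a + 5 - r] plus the number of nonhyperplane members of [S], where [r]
    is at most the number of atoms. Equality with [a + 5] needs [S] to be an independent set of
    atoms inside [P f]; otherwise the degree is too large for [residue]. *)
Lemma null_flag_P S f : S \subset G -> (forall f', P f' \notin S) ->
  ~~ exceptional f S (P f) -> null a (set_rel M G flag_val S (P f)).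
Proof.
move=> sSG nPS; rewrite /exceptional eqxx /= => nexc.
have eA := cards_split3 (atoms_of S).
rewrite /set_rel flag_sumP -/(below_in _ _) prod_flag //.
set r := M (span M _).
have sub_b : below_in S (P f) \subset atoms_of S :&: P f.
  have := @below_in_sub S (P f) set0 sSG; rewrite set0U; apply.
  move=> H HS HPf; have gH := mem_GP (subsetP sSG H HS).
  case: H / gH HPf HS => [e _||||f']; rewrite ?rk_set1 //.
  - by move/proper_sub; rewrite (negbTE (R1_nsub_hyp f)).
  - by move/proper_sub; rewrite (negbTE (R2_nsub_hyp f)).
  - by move/proper_sub; rewrite (negbTE (T_nsub_hyp f)).
  - by rewrite (negbTE (nPS f')).
have le_r : (r <= M (atoms_of S :&: P f))%N by rewrite /r rk_span rkS.
have le_rA : (r <= #|atoms_of S|)%N.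
  by rewrite (leq_trans le_r) // (leq_trans (rk_card _ _)) ?subset_leq_card ?subsetIl.
have le_rP : (r <= a + 5)%N.
  by rewrite (leq_trans le_r) // -(rkP f) rkS ?subsetIr.
set b1 := R1 \in S; set b2 := R2 \in S; set b3 := setT \in S.
have hx (i : 'I_3) : ('X_i : Q3) \is 1.-homog by rewrite dhomogX /= mdeg1.
have hx1 : (if b1 then vu - vv else 1 : Q3) \is (b1 : nat).-homog.
  by case: b1; rewrite ?dhomog1 // rpredB ?hx.
have hx2 : (if b2 then vv - vw else 1 : Q3) \is (b2 : nat).-homog.
  by case: b2; rewrite ?dhomog1 // rpredB ?hx.
have hx3 : (if b3 then vw else 1 : Q3) \is (b3 : nat).-homog.
  by case: b3; rewrite ?dhomog1 ?hx.
have hw n : vw ^+ n \is n.-homog by have := dhomogMn n (hx o2); rewrite mul1n.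
have -> : \prod_(f | P f \in S) (0 : Q3) = 1.
  by rewrite big_pred0 // => f'; apply/negbTE.
rewrite mulr1; set p := #|_ :&: R1| in eA *; set q := #|_ :\: R1| in eA *.
set s := #|_ :\: R2| in eA *.
have hc : ((-1) ^+ #|atoms_of S| : Q3) \is 0.-homog.
  have h1 : (-1 : Q3) \is 0.-homog by rewrite rpredN dhomog1.
  by have := dhomogMn #|atoms_of S| h1; rewrite mul0n.
have hom := dhomogM (dhomogM (dhomogM (dhomogM (dhomogM hc (mon_homog p q s)) hx1) hx2) hx3)
  (hw (M (P f) - r)%N).
apply: (null_homog hom).
suff: (r < #|atoms_of S|)%N || [|| b1, b2 | b3].
  by rewrite rkP; move: eA le_rA le_rP; clearbody p q s r b1 b2 b3; clear; lia.
have [//|/= nb] := boolP [|| b1, b2 | b3]; first by rewrite orbT.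
have eS : S = [set [set e] | e in atoms_of S].
  apply/setP => H; apply/idP/imsetP => [HS|[e]]; last by rewrite inE => ? ->.
  have gH := mem_GP (subsetP sSG H HS).
  move: nb; rewrite !negb_or => /and3P[].
  case: H / gH HS => [e|||| f'] HS; rewrite /b1 /b2 /b3 ?HS //.
    by exists e; rewrite ?inE.
  by have := nPS f'; rewrite HS.
move: nexc; rewrite -eS eqxx orbF /=.
have [sA /=|nsA _] := boolP (atoms_of S \subset P f).
  rewrite (setIidPl sA) in le_r => neq.
  by rewrite (leq_ltn_trans le_r) // ltn_neqAle neq rk_card.
apply: leq_ltn_trans le_r (leq_ltn_trans (rk_card _ _) (proper_card _)).
by rewrite properE subsetIl subsetI subxx.
Qed.

Lemma null_flag_rel S K : S \subset G -> K \in G ->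
  (forall f, ~~ exceptional f S K) -> null a (set_rel M G flag_val S K).
Proof.
move=> sSG KG nexc.
have [/existsP[f Pf]|/existsPn nP] := boolP [exists f, P f \in S].
  exact: null_flag_P_in Pf.
have gK := mem_GP KG; case: K / gK {KG} nexc => [e|||| f] nexc.
- exact: null_flag_set1.
- exact: null_flag_R1.
- exact: null_flag_R2.
- exact: null_flag_T.
- exact: null_flag_P.
Qed.

Lemma prod_hyp f S : S \subset G ->
  \prod_(H in S) hyp_val f H =
  (if atoms_of S \subset P f then (- vw) ^+ #|atoms_of S| else 0)
  * (if R1 \in S then 0 else 1) * (if R2 \in S then 0 else 1)
  * (if setT \in S then 0 else 1)
  * \prod_(f' | P f' \in S) (if f' == f then vw else 0).
Proof.
move=> sSG; rewrite (eq_bigl (fun H => (H \in G) && (H \in S))); last first.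
  by move=> H; rewrite andb_idl // => /(subsetP sSG).
rewrite big_G /=.
have -> : \prod_(e | [set e] \in S) hyp_val f [set e]
    = if atoms_of S \subset P f then (- vw) ^+ #|atoms_of S| else 0.
  case: ifPn => [sA|/subsetPn[e eA nP]].
    rewrite -prodr_const; apply: eq_big => e; first by rewrite inE.
    by move=> eS; rewrite hyp_val1 (subsetP sA) // inE.
  by rewrite inE in eA; rewrite (bigD1 e) //= hyp_val1 (negbTE nP) mul0r.
have -> : \prod_(f' | P f' \in S) hyp_val f (P f')
    = \prod_(f' | P f' \in S) (if f' == f then vw else 0).
  by apply: eq_bigr => f' _; rewrite hyp_valP.
by rewrite hyp_valR1 hyp_valR2 hyp_valT.
Qed.

Lemma hyp_rel_exceptional f S : exceptional f S (P f) ->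
  set_rel M G (hyp_val f) S (P f) = (-1) ^+ #|atoms_of S| * mon 0 0 (a + 5).
Proof.
case/and4P => _ /eqP eS sA /eqP iA.
have sSG : S \subset G.
  by rewrite eS; apply/subsetP => _ /imsetP[e _ ->]; apply: mem_set1.
have leA : (#|atoms_of S| <= a + 5)%N by rewrite -iA -(rkP f) rkS.
rewrite /set_rel hyp_sum ?mem_hyp // eqxx -/(below_in _ _) exceptional_below //.
rewrite prod_hyp // sA.
rewrite !(negbTE (notin_imset_atoms _ eS)) ?rkR1 ?rkR2 ?rkT; try rlia.
rewrite big_pred0 => [|f']; last first.
  by apply/negbTE/(notin_imset_atoms _ eS); rewrite rkP; rlia.
rewrite !mulr1 (exprNn vw) -mulrA -exprD rk_span iA rkP subnKC //.
by rewrite /mon !expr0 !mul1r.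
Qed.

(** The product kills every [S] with a flag member, another hyperplane or an atom outside [P f]. For
    [K] different from [P f] the linear form is 0; for [K = P f] the degree exceeds [a + 5] outside
    the exceptional case. *)
Lemma null_hyp_rel f S K : S \subset G -> K \in G ->
  ~~ exceptional f S K -> null a (set_rel M G (hyp_val f) S K).
Proof.
move=> sSG KG nexc; rewrite /set_rel hyp_sum // prod_hyp // -/(below_in _ _).
case: ifPn => [sA|_]; last by rewrite !mul0r; apply: null0.
case: ifPn => [_|nR1]; first by rewrite mulr0 !mul0r; apply: null0.
case: ifPn => [_|nR2]; first by rewrite mulr0 !mul0r; apply: null0.
case: ifPn => [_|nT]; first by rewrite mulr0 !mul0r; apply: null0.
have [/existsP[f' /andP[Pf' ne]]|/existsPn nP] :=
    boolP [exists f', (P f' \in S) && (f' != f)].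
  by rewrite (bigD1 f') //= (negbTE ne) mul0r mulr0 mul0r; apply: null0.
have sub_b : below_in S K \subset K :&: P f.
  rewrite subsetI; apply/andP; split; apply/bigcupsP => H /andP[HS HK].
    exact: proper_sub.
  have gH := mem_GP (subsetP sSG H HS).
  case: H / gH HS HK => [e||||f'] HS _.
  - by rewrite sub1set (subsetP sA) // inE.
  - by rewrite HS in nR1.
  - by rewrite HS in nR2.
  - by rewrite HS in nT.
  - by move: (nP f'); rewrite HS negbK => /eqP->.
have [sKP|nsKP] := boolP (K \subset P f); last first.
  (* Since [0 ^+ 0 = 1], the zero linear form helps only if the exponent is positive; this holds
     because the join lies in the proper subflat [K :&: P f] of [K]. *)
  rewrite ifF; last by apply/eqP => eK; rewrite eK subxx in nsKP.
  have lt_r : (M (span M (below_in S K)) < M K)%N.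
    rewrite rk_span; apply: leq_ltn_trans (rkS M sub_b) _.
    apply: flat_rk_lt; first exact: flatI (mem_flat KG) (flatP f).
    by rewrite properE subsetIl subsetI subxx.
  by rewrite expr0n subn_eq0 leqNgt lt_r mulr0; apply: null0.
have gK := mem_GP KG; case: K / gK {KG} sKP nexc sub_b => [e|||| f'].
- rewrite neq_rk; last by rewrite rk_set1 rkP; rlia.
  rewrite below_in_set1 // rk_span rk0 rk_set1 expr1 mulr0.
  by move=> *; apply: null0.
- by rewrite (negbTE (R1_nsub_hyp f)).
- by rewrite (negbTE (R2_nsub_hyp f)).
- by rewrite (negbTE (T_nsub_hyp f)).
rewrite sub_hyp => /eqP-> {f'}; rewrite eqxx => nexc _.
have hx : (vw : Q3) \is 1.-homog by rewrite dhomogX /= mdeg1.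
have hw n : vw ^+ n \is n.-homog by have := dhomogMn n hx; rewrite mul1n.
have sub_A : below_in S (P f) \subset atoms_of S.
  have := @below_in_sub S (P f) set0 sSG; rewrite set0U => h.
  apply: subset_trans (h _) (subsetIl _ _).
  move=> H HS HPf; have gH := mem_GP (subsetP sSG H HS).
  case: H / gH HPf HS => [e _||||f']; rewrite ?rk_set1 //.
  - by rewrite (negbTE nR1).
  - by rewrite (negbTE nR2).
  - by rewrite (negbTE nT).
  - by move=> /[swap] HS; move: (nP f'); rewrite HS negbK => /eqP->; rewrite properxx.
have le_r : (M (span M (below_in S (P f))) <= M (atoms_of S))%N.
  by rewrite rk_span rkS.
have le_A := rk_card M (atoms_of S).
have le_P : (M (atoms_of S) <= a + 5)%N by rewrite -(rkP f) rkS.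
have hA : (- vw) ^+ #|atoms_of S| \is #|atoms_of S|.-homog.
  by have := dhomogMn #|atoms_of S| (_ : - vw \is 1.-homog); rewrite mul1n; apply;
    rewrite rpredN.
set r := M (span M _) in le_r *.
have [PfS|nPfS] := boolP (P f \in S).
  rewrite (bigD1 f) //= eqxx big1 => [|f' /andP[Pf' ne]]; last first.
    by move: (nP f'); rewrite Pf' ne.
  rewrite !mulr1 -mulrA; apply: null_homog (dhomogM hA (dhomogM hx (hw _))) _.
  by rewrite rkP; move: le_r le_A le_P; clear; lia.
rewrite big_pred0 => [|f']; last first.
  apply/negbTE/negP => PS; have := nP f'; rewrite PS negbK => /eqP e.
  by rewrite -e PS in nPfS.
rewrite !mulr1; apply: null_homog (dhomogM hA (hw _)) _.
have eS : S = [set [set e] | e in atoms_of S].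
  apply/setP => H; apply/idP/imsetP => [HS|[e]]; last by rewrite inE => ? ->.
  have gH := mem_GP (subsetP sSG H HS).
  case: H / gH HS => [e|||| f'] HS.
  - by exists e; rewrite ?inE.
  - by rewrite HS in nR1.
  - by rewrite HS in nR2.
  - by rewrite HS in nT.
  - by move: (nP f'); rewrite HS negbK => /eqP e; rewrite e (negbTE nPfS) in HS.
move: nexc; rewrite /exceptional eqxx -eS eqxx sA /= => ne.
by rewrite rkP; move: ne le_r le_A le_P; clear; lia.
Qed.

(** * The degree map on the Chow ring *)

Local Notation Pol := {mpoly rat[#|G|]}.
Local Notation ideal := (@chow_ideal E M G).

(** The minus sign of the hyperplane parts reflects [x_(P f)^(a + 5) = - w^(a + 5)]. *)
Definition chow_deg (p : Pol) : rat :=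
  residue a (ev flag_val p) - \sum_f residue a (ev (hyp_val f) p).

Lemma chow_degD p q : chow_deg (p + q) = chow_deg p + chow_deg q.
Proof.
have evD F : residue a (ev F (p + q)) = residue a (ev F p) + residue a (ev F q).
  by rewrite /ev mmapD residueD.
rewrite /chow_deg evD (eq_bigr _ (fun f _ => evD (hyp_val f))).
by rewrite big_split opprD addrACA.
Qed.

Lemma chow_degZ c p : chow_deg (c *: p) = c * chow_deg p.
Proof.
have evZ F : residue a (ev F (c *: p)) = c * residue a (ev F p).
  by rewrite /ev mmapZ mul_mpolyC residueZ.
rewrite /chow_deg evZ (eq_bigr _ (fun f _ => evZ (hyp_val f))).
by rewrite -mulr_sumr mulrBr.
Qed.

Lemma chow_deg_sum (T : Type) (r : seq T) (C : pred T) (F : T -> Pol) :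
  chow_deg (\sum_(t <- r | C t) F t) = \sum_(t <- r | C t) chow_deg (F t).
Proof.
apply: (big_morph chow_deg chow_degD).
by rewrite -(scale0r (0 : Pol)) chow_degZ mul0r.
Qed.

Lemma mcoeff0_var (i : 'I_3) : ('X_i : Q3)@_0%MM = 0.
Proof. by rewrite mcoeffX -mdeg_eq0 mdeg1. Qed.

Lemma mcoeff0_flag H : H \in G -> (flag_val H)@_0%MM = 0.
Proof.
case/mem_GP => [e|||| f].
- by rewrite flag_val1 mcoeffN /ylin; do 2?case: ifP => _; rewrite mcoeff0_var oppr0.
- by rewrite flag_valR1 mcoeffB !mcoeff0_var subr0.
- by rewrite flag_valR2 mcoeffB !mcoeff0_var subr0.
- by rewrite flag_valT mcoeff0_var.
- by rewrite flag_valP mcoeff0.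
Qed.

Lemma mcoeff0_hyp f H : H \in G -> (hyp_val f H)@_0%MM = 0.
Proof.
by move=> _; rewrite /hyp_val; do 2?case: ifP => _; rewrite ?mcoeffN ?mcoeff0_var ?oppr0 ?mcoeff0.
Qed.

Lemma residue_sign n (p q : Q3) :
  residue a (q * ((-1) ^+ n * p)) = (-1) ^+ n * residue a (q * p).
Proof.
rewrite -!(signr_odd _ n); case: (odd n); rewrite ?expr0 ?mul1r // expr1.
by rewrite !mulN1r mulrN residueN.
Qed.

Lemma chow_deg_rel (q : Pol) (S : {set 'I_#|G|}) g : chow_deg (q * chow_rel M S g) = 0.
Proof.
rewrite /chow_deg.
have evM F : ev F (q * chow_rel M S g) =
    ev F q * set_rel M G F [set enum_val i | i in S] (enum_val g).
  by rewrite -ev_chow_rel /ev rmorphM.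
rewrite evM (eq_bigr _ (fun f _ => congr1 (residue a) (evM (hyp_val f)))).
have : [set @enum_val _ (mem G) i | i in S] \subset G.
  by apply/subsetP => _ /imsetP[i _ ->]; apply: enum_valP.
have : @enum_val _ (mem G) g \in G by apply: enum_valP.
move: (enum_val g) [set _ | _ in S] => K {evM}S KG sSG.
have [/existsP[f exc]|/existsPn nexc] := boolP [exists f, exceptional f S K].
  have eK : K = P f by case/and4P: exc => /eqP.
  rewrite eK in exc KG *.
  have [i [j [k [tm ->]]]] := flag_rel_exceptional exc.
  rewrite (bigD1 f) //= big1 => [|f' ne]; last first.
    apply: null_hyp_rel; rewrite ?mem_hyp // /exceptional (inj_eq injP) eq_sym.
    by rewrite (negbTE ne).
  (* Both surviving contributions equal the same sign times the constant term of [q], so they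
     cancel. *)
  rewrite (hyp_rel_exceptional exc) !residue_sign !residue_mul_top //; last first.
    by rewrite /top_mon; rlia.
  by rewrite !mcoeff0_ev ?addr0 ?subrr //; [exact: mcoeff0_hyp | exact: mcoeff0_flag].
have e0 : residue a (ev flag_val q * set_rel M G flag_val S K) = 0.
  by apply: null_flag_rel.
have e1 : \sum_f residue a (ev (hyp_val f) q * set_rel M G (hyp_val f) S K) = 0.
  by apply: big1 => f _; apply: null_hyp_rel.
exact: etrans (congr2 (fun y z => y - z) e0 e1) (subrr 0).
Qed.

Lemma chow_deg_ideal q p : ideal p -> chow_deg (q * p) = 0.
Proof.
move=> [c ->]; rewrite mulr_sumr chow_deg_sum big1 // => S _.
rewrite mulr_sumr chow_deg_sum big1 // => g _.
by rewrite mulrA chow_deg_rel.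
Qed.

(** * Relations between u, v, w and the hyperplane variables *)

Local Notation x H := (xvar G H).

Definition var_U : Pol := x R1 + x R2 + x setT.
Definition var_V : Pol := x R2 + x setT.
Definition var_W : Pol := x setT.
Definition uvw (i j k : nat) : Pol := var_U ^+ i * var_V ^+ j * var_W ^+ k.

Lemma ideal_U : ideal (var_U ^+ a).
Proof.
have := set_rel_ideal M (sub0set G) mem_R1.
rewrite /set_rel big_set0 mul1r sumG_gt1 ?rkR1 // subxx sR12.
have -> : \sum_(f | R1 \subset P f) x (P f) = 0.
  by rewrite big_pred0 // => f; apply/negbTE/R1_nsub_hyp.
by rewrite big_pred0 ?rk_span ?rk0 ?subn0 ?addr0 // => H; rewrite inE.
Qed.

Lemma below_set1 (H K : {set E}) : H \proper K ->
  \bigcup_(H' in [set H] | H' \proper K) H' = H.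
Proof. by move=> HK; rewrite big_mkcondr big_set1 HK. Qed.

(** This is the relation for [S = [set R1]] and [K = R2]: [x R1] is [var_U - var_V], and the
    exponent is the rank gap 3. *)
Lemma ideal_V : ideal ((var_U - var_V) * var_V ^+ 3).
Proof.
have R12 : R1 \proper R2.
  by rewrite properE sR12 subset_rk // rkR1 rkR2; rlia.
have s1 : [set R1] \subset G by rewrite sub1set mem_R1.
have := set_rel_ideal M s1 mem_R2.
rewrite /set_rel big_set1 below_set1 // sumG_gt1 ?rkR2; last by rlia.
rewrite subxx (negbTE (subset_rk _)) ?rkR1 ?rkR2; last by rlia.
rewrite big_pred0 ?addr0 ?add0r => [|f]; last exact/negbTE/R2_nsub_hyp.
rewrite rk_span rkR1 addnC addnK.
by rewrite (_ : var_U - var_V = x R1) // /var_U /var_V; ring.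
Qed.

Lemma proper_R2T : R2 \proper setT.
Proof. by rewrite properE subsetT subset_rk // rkT rkR2; rlia. Qed.

Lemma sum_T (V : nmodType) (F : {set E} -> V) : 
  \sum_(H in G | setT \subset H) F H = F setT.
Proof.
rewrite sumG_gt1 ?rkT; last by rlia.
rewrite !(negbTE (subset_rk _)) ?rkR1 ?rkR2 ?rkT; try rlia.
by rewrite big_pred0 ?addr0 ?add0r // => f; apply/negbTE/T_nsub_hyp.
Qed.

Lemma ideal_W : ideal ((var_V - var_W) * var_W ^+ 3).
Proof.
have s1 : [set R2] \subset G by rewrite sub1set mem_R2.
have := set_rel_ideal M s1 mem_T.
rewrite /set_rel big_set1 below_set1 ?proper_R2T // sum_T rk_span rkT rkR2.
rewrite (_ : a + 6 - (a + 3) = 3)%N; last by rlia.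
by rewrite (_ : var_V - var_W = x R2) // /var_V /var_W; ring.
Qed.

Lemma proper_hypT f : P f \proper setT.
Proof. by rewrite properE subsetT T_nsub_hyp. Qed.

Lemma ideal_PW f : ideal (x (P f) * var_W).
Proof.
have s1 : [set P f] \subset G by rewrite sub1set mem_hyp.
have := set_rel_ideal M s1 mem_T.
rewrite /set_rel big_set1 below_set1 ?proper_hypT // sum_T rk_span rkT rkP.
by rewrite (_ : a + 6 - (a + 5) = 1)%N ?expr1 //; rlia.
Qed.

(** A flat not contained in [P f] spans the whole matroid together with it, so the relation for [S =
    [set P f; H]] at the ground set has exponent 0. *)
Lemma ideal_P_other f H : H \in G -> H \proper setT -> ~~ (H \subset P f) ->
  ideal (x (P f) * x H).
Proof.
move=> HG HT nH; have ne : P f != H by apply: contraNneq nH => <-.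
have s1 : [set P f; H] \subset G by rewrite subUset !sub1set mem_hyp.
have := set_rel_ideal M s1 mem_T.
rewrite /set_rel big_setU1 ?inE //= big_set1 sum_T.
rewrite big_mkcondr big_setU1 ?inE //= big_set1 proper_hypT HT.
rewrite rk_span [X in _ ^+ X](_ : _ = 0%N) ?mulr1 //.
apply/eqP; rewrite subn_eq0 rkT.
have : (M (P f) < M (P f :|: H))%N.
  apply: flat_rk_lt => //; rewrite properE subsetUl subUset subxx /=.
  exact: nH.
by rewrite rkP; rlia.
Qed.

Lemma ideal_PP f f' : f != f' -> ideal (x (P f) * x (P f')).
Proof.
move=> ne; apply: ideal_P_other (mem_hyp f') (proper_hypT f') _.
by rewrite sub_hyp eq_sym.
Qed.

Lemma ideal_PV f : ideal (x (P f) * var_V).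
Proof.
rewrite mulrDr; apply: chow_idealD (ideal_PW f).
exact: ideal_P_other mem_R2 proper_R2T (R2_nsub_hyp f).
Qed.

Lemma ideal_PU f : ideal (x (P f) * var_U).
Proof.
rewrite /var_U -addrA mulrDr; apply: chow_idealD (ideal_PV f).
exact: ideal_P_other mem_R1 (sub_proper_trans sR12 proper_R2T) (R1_nsub_hyp f).
Qed.

(** Modulo [y * z] the mixed terms disappear. It is applied to [x setT] and [x (P f)], whose product
    is in the ideal. *)
Lemma expD_mod (A : comNzRingType) (y z : A) n :
  exists c, (y + z) ^+ n.+1 = y ^+ n.+1 + z ^+ n.+1 + c * (y * z).
Proof.
elim: n => [|n [c IH]]; first by exists 0; rewrite !expr1; ring.
exists (y ^+ n + z ^+ n + c * (y + z)); rewrite exprS IH !exprS; ring.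
Qed.

Lemma ideal_Ptop f : ideal (x (P f) ^+ (a + 5) + var_W ^+ (a + 5)).
Proof.
have := set_rel_ideal M (sub0set G) (mem_hyp f).
rewrite /set_rel big_set0 mul1r sumG_gt1 ?rkP; last by rlia.
rewrite !(negbTE (subset_rk _)) ?rkR1 ?rkR2 ?rkP; try rlia.
rewrite (big_pred1 f) => [|f']; last by rewrite sub_hyp eq_sym.
rewrite big_pred0 ?rk_span ?rk0 ?subn0 ?add0r => [|H]; last by rewrite inE.
rewrite addnS; have [c ->] := expD_mod (x setT) (x (P f)) (a + 4).
rewrite [x setT * _]mulrC => h.
have := chow_idealB h (chow_idealM c (ideal_PW f)).
by rewrite addrK addrC.
Qed.

Lemma ideal_atom e : ideal (x [set e] - 
  (- ((if e \in R1 then x R1 else 0) + (if e \in R2 then x R2 else 0)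
    + x setT + \sum_(f | e \in P f) x (P f)))).
Proof.
have := set_rel_ideal M (sub0set G) (mem_set1 e).
rewrite /set_rel big_set0 mul1r sumG1.
rewrite big_pred0 ?rk_span ?rk0 ?rk_set1 ?expr1 => [|H]; last by rewrite inE.
by rewrite opprK !addrA.
Qed.

(** * Spanning by the monomial basis *)

Local Notation idx := ('I_4 * 'I_4 + 'I_N)%type.

(** For [inl (j, k)] the exponent of u is forced to be [d - j - k], and the bounds say that it is a
    natural number below [a]. Hyperplane powers stop before degree [a + 5], where they become
    [- w^(a + 5)], and start in degree 1 so that the unit is counted once. *)
Definition in_degree (d : nat) (t : idx) : bool :=
  match t with
  | inl (j, k) => (j + k <= d < a + j + k)%N
  | inr _ => (0 < d < a + 5)%N
  end.

Definition basis_elt (d : nat) (t : idx) : Pol :=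
  match t with
  | inl (j, k) => uvw (d - j - k) j k
  | inr f => x (P f) ^+ d
  end.

Definition spanned (d : nat) (p : Pol) : Prop :=
  exists c : idx -> rat,
    ideal (p - \sum_(t | in_degree d t) c t *: basis_elt d t).

Lemma spanned_ideal d p : ideal p -> spanned d p.
Proof.
move=> Ip; exists (fun=> 0); rewrite big1 ?subr0 // => t _.
by rewrite scale0r.
Qed.

Lemma spannedD d p q : spanned d p -> spanned d q -> spanned d (p + q).
Proof.
move=> [c Ip] [c' Iq]; exists (fun t => c t + c' t).
rewrite (eq_bigr _ (fun t _ => scalerDl (basis_elt d t) (c t) (c' t))).
by rewrite big_split opprD addrACA; apply: chow_idealD.
Qed.

Lemma spannedZ d z p : spanned d p -> spanned d (z *: p).
Proof.
move=> [c Ip]; exists (fun t => z * c t).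
have -> : \sum_(t | in_degree d t) (z * c t) *: basis_elt d t =
    z *: \sum_(t | in_degree d t) c t *: basis_elt d t.
  by rewrite scaler_sumr; apply: eq_bigr => t _; rewrite scalerA.
by rewrite -scalerBr; apply: chow_idealZ.
Qed.

Lemma spanned_congr d p q : ideal (p - q) -> spanned d q -> spanned d p.
Proof. by move=> /(spanned_ideal d) h /(spannedD h); rewrite subrK. Qed.

Lemma spanned_sum d (T : Type) (r : seq T) (C : pred T) (F : T -> Pol) :
  (forall t, C t -> spanned d (F t)) -> spanned d (\sum_(t <- r | C t) F t).
Proof.
move=> h; apply: (big_ind (spanned d)) => //; last exact: spannedD.
exact/spanned_ideal/chow_ideal0.
Qed.

Lemma spanned_basis d t : in_degree d t -> spanned d (basis_elt d t).
Proof.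
move=> dt; exists (fun t' => (t' == t)%:R).
rewrite (bigD1 t) //= eqxx scale1r big1 ?addr0 ?subrr; first exact: chow_ideal0.
by move=> t' /andP[_ /negbTE->]; rewrite scale0r.
Qed.

(** While the exponent of v is at least 4, one v is replaced by a u through [ideal_V]; once it is at
    most 3, the monomial is a basis element or is killed by [u^a]. *)
Lemma spanned_uvw_ord i j (k : 'I_4) : spanned (i + j + k) (uvw i j k).
Proof.
elim: j i => [|j IHj] i.
  have [lt_i|le_i] := ltnP i a.
    have := @spanned_basis (i + 0 + k) (inl (ord0, k)).
    rewrite /= subn0 addnK addn0; apply; rewrite addn0 add0n leq_addl /=.
    by rewrite ltn_add2r.
  apply: spanned_ideal.
  have -> : uvw i 0 k = var_U ^+ (i - a) * var_W ^+ k * var_U ^+ a.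
    by rewrite /uvw -{1}(subnK le_i) exprD expr0; ring.
  exact/chow_idealM/ideal_U.
have [lt_j|le_j] := ltnP j.+1 4.
  have [lt_i|le_i] := ltnP i a.
    have := @spanned_basis (i + j.+1 + k) (inl (Ordinal lt_j, k)).
    rewrite /= -subnDA -addnA addnK; apply; rewrite leq_addl /=.
    by rewrite -addnA ltn_add2r.
  apply: spanned_ideal.
  have -> : uvw i j.+1 k = var_U ^+ (i - a) * var_V ^+ j.+1 * var_W ^+ k * var_U ^+ a.
    by rewrite /uvw -{1}(subnK le_i) exprD; ring.
  exact/chow_idealM/ideal_U.
have := IHj i.+1; rewrite addSnnS; apply: spanned_congr.
have -> : uvw i j.+1 k - uvw i.+1 j k =
   - (var_U ^+ i * var_V ^+ (j - 3) * var_W ^+ k) * ((var_U - var_V) * var_V ^+ 3).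
  rewrite /uvw (exprS _ i) (exprS _ j) -{1 2}(subnK (le_j : 3 <= j)%N).
  by rewrite (exprD _ _ 3); ring.
exact/chow_idealM/ideal_V.
Qed.

Lemma spanned_uvw i j k : spanned (i + j + k) (uvw i j k).
Proof.
elim: k i j => [|k IHk] i j; first exact: (spanned_uvw_ord i j ord0).
have [lt_k|le_k] := ltnP k.+1 4; first exact: (spanned_uvw_ord i j (Ordinal lt_k)).
have := IHk i j.+1; rewrite !addnS addSn; apply: spanned_congr.
have -> : uvw i j k.+1 - uvw i j.+1 k =
   - (var_U ^+ i * var_V ^+ j * var_W ^+ (k - 3)) * ((var_V - var_W) * var_W ^+ 3).
  rewrite /uvw (exprS _ k) (exprS _ j) -{1 2}(subnK (le_k : 3 <= k)%N).
  by rewrite (exprD _ _ 3); ring.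
exact/chow_idealM/ideal_W.
Qed.

Lemma ideal_P_uvw f i j k : (0 < i + j + k)%N -> ideal (x (P f) * uvw i j k).
Proof.
rewrite /uvw; case: k => [|k] => [|_].
  case: j => [|j] => [|_].
    case: i => [//|i] _; rewrite !expr0 !mulr1 exprSr mulrCA.
    exact/chow_idealM/ideal_PU.
  rewrite expr0 mulr1 exprSr mulrA mulrCA.
  exact/chow_idealM/ideal_PV.
rewrite exprSr mulrA mulrCA.
exact/chow_idealM/ideal_PW.
Qed.

Lemma spanned_P f d : spanned d.+1 (x (P f) ^+ d.+1).
Proof.
have [lt_d|] := ltnP d.+1 (a + 5); first exact: (@spanned_basis _ (inr f)).
rewrite leq_eqVlt => /orP[/eqP <-|lt_d].
  have := spannedZ (-1) (spanned_uvw 0 0 (a + 5)); apply: spanned_congr.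
  by rewrite /uvw !expr0 !mul1r scaleN1r opprK; apply: ideal_Ptop.
apply: spanned_ideal; rewrite -(subnK lt_d) exprD; apply: chow_idealM.
have -> : x (P f) ^+ (a + 5).+1 =
    x (P f) * (x (P f) ^+ (a + 5) + var_W ^+ (a + 5)) - x (P f) * uvw 0 0 (a + 5).
  by rewrite /uvw !expr0 !mul1r mulrDr addrK exprS.
apply: chow_idealB; first exact/chow_idealM/ideal_Ptop.
by apply: ideal_P_uvw; rlia.
Qed.

(** Multiplication by [y] respects the candidate basis degree by degree. Once this is known for
    every variable, all monomials are spanned by induction on the degree. *)
Definition raises (y : Pol) : Prop :=
  forall d p, spanned d p -> spanned d.+1 (y * p).

Lemma raises_basis y :
  (forall d t, in_degree d t -> spanned d.+1 (y * basis_elt d t)) -> raises y.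
Proof.
move=> h d p [c Ip].
apply: (@spanned_congr _ _ (y * \sum_(t | in_degree d t) c t *: basis_elt d t)).
  by rewrite -mulrBr; apply: chow_idealM.
rewrite mulr_sumr; apply: spanned_sum => t dt.
by rewrite -scalerAr; apply/spannedZ/h.
Qed.

Lemma raisesD y z : raises y -> raises z -> raises (y + z).
Proof. by move=> hy hz d p hp; rewrite mulrDl; apply: spannedD; auto. Qed.

Lemma raisesN y : raises y -> raises (- y).
Proof.
move=> hy d p hp; rewrite mulNr -mulrN; apply: hy.
by rewrite -scaleN1r; apply: spannedZ.
Qed.

Lemma raises_congr y z : ideal (y - z) -> raises z -> raises y.
Proof.
move=> Iyz hz d p hp; apply: spanned_congr (hz d p hp).
by rewrite -mulrBl mulrC; apply: chow_idealM.
Qed.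

Lemma raises0 : raises 0.
Proof. by move=> d p _; rewrite mul0r; apply/spanned_ideal/chow_ideal0. Qed.

Lemma raises_uvw y : 
  (forall i j k, spanned (i + j + k).+1 (y * uvw i j k)) ->
  (forall f, ideal (x (P f) * y)) -> raises y.
Proof.
move=> h1 h2; apply: raises_basis => d [[j k]|f] /=.
  move=> /andP[le_d _]; have := h1 (d - j - k)%N j k.
  by rewrite -addnA -subnDA subnK.
case: d => [//|d] _; apply: spanned_ideal.
by rewrite exprSr mulrC -mulrA; apply/chow_idealM/h2.
Qed.

Lemma raises_U : raises var_U.
Proof.
apply: raises_uvw ideal_PU => i j k.
by have := spanned_uvw i.+1 j k; rewrite /uvw exprS !mulrA.
Qed.

Lemma raises_V : raises var_V.
Proof.
apply: raises_uvw ideal_PV => i j k.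
have := spanned_uvw i j.+1 k; rewrite addnS addSn.
by congr spanned; rewrite /uvw exprS; ring.
Qed.

Lemma raises_W : raises var_W.
Proof.
apply: raises_uvw ideal_PW => i j k.
have := spanned_uvw i j k.+1; rewrite addnS.
by congr spanned; rewrite /uvw exprS; ring.
Qed.

Lemma raises_P f : raises (x (P f)).
Proof.
apply: raises_basis => d [[j k]|f'] /=.
  move=> /andP[le_d _]; case: d le_d => [le0|d le_d].
    have [-> ->] : (j = 0 :> nat /\ k = 0 :> nat)%N by move: le0; clear; lia.
    rewrite /uvw !expr0 !mulr1; exact: (spanned_P f 0).
  apply/spanned_ideal/ideal_P_uvw.
  by move: le_d; clear; lia.
case: d => // d _; have [<-|ne] := eqVneq f f'.
  by rewrite -exprS; apply: spanned_P.
by apply: spanned_ideal; rewrite exprSr mulrCA; apply/chow_idealM/ideal_PP.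
Qed.

Lemma raises_R1 : raises (x R1).
Proof.
have -> : x R1 = var_U - var_V by rewrite /var_U /var_V; ring.
exact/raisesD/raisesN/raises_V/raises_U.
Qed.

Lemma raises_R2 : raises (x R2).
Proof.
have -> : x R2 = var_V - var_W by rewrite /var_V /var_W; ring.
exact/raisesD/raisesN/raises_W/raises_V.
Qed.

Lemma raises_xvar H : H \in G -> raises (x H).
Proof.
case/mem_GP => [e|||| f].
- apply: raises_congr (ideal_atom e) _; apply/raisesN/raisesD; last first.
    apply: (big_ind raises) => [|y z|f _]; [exact: raises0 | exact: raisesD | exact: raises_P].
  apply: raisesD raises_W; apply: raisesD; case: ifP => _;
    [exact: raises_R1 | exact: raises0 | exact: raises_R2 | exact: raises0].
- exact: raises_R1.
- exact: raises_R2.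
- exact: raises_W.
- exact: raises_P.
Qed.

Lemma spanned_homog d (p : Pol) : p \is d.-homog -> spanned d p.
Proof.
move/dhomogP => hp; rewrite [p]mpolyE big_seq; apply: spanned_sum => m /hp /=.
move=> dm; apply: spannedZ; elim: d m dm {hp} => [|n IH] m.
  move/eqP; rewrite mdeg_eq0 => /eqP ->; rewrite mpolyX0.
  by have := spanned_uvw 0 0 0; rewrite /uvw !expr0 !mulr1.
move=> dm; have [i mi] : exists i, m i != 0%N.
  apply/existsP; apply: contraT => /existsPn h.
  move: dm; rewrite mdegE big1 // => i _; apply/eqP.
  by move: (h i); rewrite negbK.
have le_i : (U_(i) <= m)%MM by rewrite lep1mP.
rewrite -(submK le_i) addmC mpolyXD -xvar_elt.
have dm' : mdeg (m - U_(i))%MM = n.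
  by move: dm; rewrite -{1}(submK le_i) mdegD mdeg1 addn1 => -[].
by apply: raises_xvar (enum_valP i) _ _ _; apply: IH.
Qed.

(** * Linear independence through the degree pairing *)

Lemma chow_deg_uvw i j k : (0 < i + j + k)%N ->
  chow_deg (uvw i j k) = (top_mon a i j k)%:R.
Proof.
move=> gt0.
have evF F : ev F (uvw i j k) = (F R1 + F R2 + F setT) ^+ i
    * (F R2 + F setT) ^+ j * F setT ^+ k.
  by rewrite -(@ev_xvar _ G F _ mem_R1) -(@ev_xvar _ G F _ mem_R2) -(@ev_xvar _ G F _ mem_T) /ev !rmorphM !rmorphXn !rmorphD.
rewrite /chow_deg (eq_bigr (fun=> 0)) => [|f _]; last first.
  rewrite evF hyp_valR1 hyp_valR2 hyp_valT !addr0 !expr0n -!natrM.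
  suff -> : ((i == 0) * (j == 0) * (k == 0) = 0)%N by rewrite residue0.
  by move: gt0; clear; case: i j k => [|?] [|?] [|?].
rewrite big1_eq subr0 evF flag_valR1 flag_valR2 flag_valT.
have -> : vu - vv + (vv - vw) + vw = vu by ring.
by rewrite subrK -/(mon i j k) residue_mon.
Qed.

Lemma chow_deg_P f n : (0 < n)%N ->
  chow_deg (x (P f) ^+ n) = - (top_mon a 0 0 n)%:R.
Proof.
move=> n_gt0.
have evF F : ev F (x (P f) ^+ n) = F (P f) ^+ n.
  by rewrite -(@ev_xvar _ G F _ (mem_hyp f)) /ev !rmorphXn.
rewrite /chow_deg evF flag_valP expr0n eqn0Ngt n_gt0 residue0 sub0r; congr (- _).
rewrite (bigD1 f) //= big1 => [|f' ne]; rewrite evF hyp_valP.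
  rewrite eqxx addr0 -residue_mon; congr residue.
  by rewrite /mon !expr0 !mul1r.
by rewrite eq_sym (negbTE ne) expr0n eqn0Ngt n_gt0 residue0.
Qed.

Lemma chow_deg0 p : ideal p -> chow_deg p = 0.
Proof. by move=> /(chow_deg_ideal 1); rewrite mul1r. Qed.

Section Independence.

Variables (d : nat) (c : idx -> rat).
Hypothesis Ic : ideal (\sum_(t | in_degree d t) c t *: basis_elt d t).

Lemma pairing_eq0 q :
  \sum_(t | in_degree d t) c t * chow_deg (q * basis_elt d t) = 0.
Proof.
rewrite -[RHS](chow_deg_ideal q Ic) mulr_sumr chow_deg_sum.
by apply: eq_bigr => t _; rewrite -scalerAr chow_degZ.
Qed.

(** Pairing with the complementary power [x (P f) ^+ (a + 5 - d)] isolates this coefficient: every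
    other basis element times that power is in the ideal, while the diagonal entry is -1. *)
Lemma coef_hyp_eq0 f : in_degree d (inr f) -> c (inr f) = 0.
Proof.
move=> /[dup] df /= /andP[d_gt0 d_lt].
have := pairing_eq0 (x (P f) ^+ (a + 5 - d)).
rewrite (bigD1 (inr f)) //= -exprD subnK ?(ltnW d_lt) // chow_deg_P; last first.
  by rewrite addnS.
have -> : top_mon a 0 0 (a + 5) by rewrite /top_mon; rlia.
have [n en] : exists n, (a + 5 - d)%N = n.+1.
  by exists (a + 5 - d).-1; rewrite prednK // subn_gt0.
rewrite big1 => [|t /andP[dt ne]]; last first.
  rewrite chow_deg0 ?mulr0 // en.
  case: t dt ne => [[j k] /= /andP[le_d _] _|f' _ ne] /=.
    rewrite exprSr -mulrA; apply/chow_idealM/ideal_P_uvw.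
    by rewrite -addnA -subnDA subnK.
  rewrite exprSr -mulrA; apply: chow_idealM.
  rewrite -(prednK d_gt0) exprSr mulrCA; apply/chow_idealM/ideal_PP.
  by apply: contraNneq ne => ->.
by rewrite addr0 mulrN1 => /eqP; rewrite oppr_eq0 => /eqP.
Qed.

Lemma coef_uvw_eq0 j k : in_degree d (inl (j, k)) -> c (inl (j, k)) = 0.
Proof.
(* Decreasing induction on [j + 2k], whose maximum is 9. The conditions [k <= k'] and
   [j + k <= j' + k'] make [j' + 2k'] strictly larger unless the pairs agree, so the pairing matrix
   is unitriangular. *)
have [n] := ubnP (9 - (j + k + k)); elim: n j k => // n IH j k lt_n djk.
have /= /andP[le_d lt_d] := djk.
set i := (d - j - k)%N; have ei : (i + j + k = d)%N.
  by rewrite /i -addnA -subnDA subnK.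
(* The test monomial completes [uvw i j k] to [uvw (a - 1) 3 3], which has degree [a + 5]. *)
have pair (j' k' : 'I_4) : in_degree d (inl (j', k')) ->
    chow_deg (uvw (a - 1 - i) (3 - j) (3 - k) * basis_elt d (inl (j', k')))
    = ((k <= k') && (j + k <= j' + k'))%N%:R.
  move=> /= /andP[le_d' lt_d'].
  have -> : uvw (a - 1 - i) (3 - j) (3 - k) * uvw (d - j' - k') j' k'
      = uvw (a - 1 - i + (d - j' - k')) (3 - j + j') (3 - k + k').
    by rewrite /uvw !exprD; ring.
  have [lj lk] := (ltn_ord j, ltn_ord k).
  have ltia : (i < a)%N by move: lt_d ei; clear; lia.
  rewrite chow_deg_uvw.
    congr (_%:R); congr nat_of_bool; rewrite /top_mon.
    by move: ltia ei le_d' lt_d' lj lk; clear; lia.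
  by move: ltia ei le_d' lt_d' lj lk; clear; lia.
have := pairing_eq0 (uvw (a - 1 - i) (3 - j) (3 - k)).
rewrite (bigD1 (inl (j, k))) // pair // !leqnn mulr1.
rewrite big1 => [|t /andP[dt ne]]; first by rewrite /= addr0.
case: t dt ne => [[j' k'] djk' ne|f df _]; last by rewrite coef_hyp_eq0 ?mul0r.
rewrite pair //; case: andP => [[le1 le2]|_]; last by rewrite mulr0.
rewrite IH ?mul0r //.
have : (j != j' :> nat) || (k != k' :> nat).
  by apply: contraNT ne; rewrite negb_or !negbK => /andP[/eqP/val_inj-> /eqP/val_inj->].
have [lj lk] := (ltn_ord j', ltn_ord k').
by move: lt_n le1 le2 lj lk; clear; lia.
Qed.

End Independence.

(** * The Hilbert function and its failure of log-concavity *)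

Definition chow_basis (d : nat) : {set idx} := [set t | in_degree d t].

Lemma xvar_homog H : H \in G -> x H \is 1.-homog.
Proof.
by move=> HG; rewrite -(enum_rankK_in HG HG) xvar_elt dhomogX /= mdeg1.
Qed.

Lemma basis_homog d t : in_degree d t -> basis_elt d t \is d.-homog.
Proof.
have hX n H : H \in G -> x H ^+ n \is n.-homog.
  by move=> /xvar_homog /(dhomogMn n); rewrite mul1n.
case: t => [[j k]|f] /=; last by move=> _; apply/hX/mem_hyp.
have hU : var_U \is 1.-homog by rewrite !rpredD ?xvar_homog ?mem_R1 ?mem_R2 ?mem_T.
have hV : var_V \is 1.-homog by rewrite !rpredD ?xvar_homog ?mem_R2 ?mem_T.
move=> /andP[le_d _].
have := dhomogM (dhomogM (dhomogMn (d - j - k) hU) (dhomogMn j hV)) (hX k _ mem_T).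
by rewrite !mul1n -addnA -subnDA subnK.
Qed.

Lemma chow_dim_flag d : chow_dim M G d #|chow_basis d|.
Proof.
exists (fun j => basis_elt d (enum_val j)); split => [j|p /spanned_homog[c Ip]|c].
- by apply: basis_homog; have := enum_valP j; rewrite inE.
- exists (fun j => c (enum_val j)); move: Ip.
  rewrite (eq_bigl (fun t => t \in chow_basis d)) => [|t]; last by rewrite inE.
  by rewrite big_enum_val.
pose c' t := \sum_(j | enum_val j == t) c j.
have c'E j : c' (enum_val j) = c j.
  rewrite /c' (bigD1 j) //= big1 ?addr0 // => j' /andP[/eqP/enum_val_inj->].
  by rewrite eqxx.
have -> : \sum_j c j *: basis_elt d (enum_val j) =
    \sum_(t | in_degree d t) c' t *: basis_elt d t.
  rewrite [RHS](eq_bigl (fun t => t \in chow_basis d)) => [|t]; last by rewrite inE.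
  by rewrite [RHS]big_enum_val; apply: eq_bigr => j _; rewrite c'E.
move=> Ic j; rewrite -c'E.
have := enum_valP j; rewrite inE.
case: (enum_val j) => [[i k]|f]; [exact: coef_uvw_eq0 | exact: coef_hyp_eq0].
Qed.

Definition flag_hilbert : {poly nat} := \poly_(d < a + 6) #|chow_basis d|.

Lemma flag_hilbertE d : flag_hilbert`_d = #|chow_basis d|.
Proof.
rewrite coef_poly; case: ltnP => // le_d; apply/esym/eqP.
rewrite cards_eq0; apply/eqP/setP => -[[j k]|f]; rewrite !inE /=.
  have [lj lk] := (ltn_ord j, ltn_ord k).
  by move: le_d lj lk; clear; lia.
by move: le_d; clear; lia.
Qed.

Lemma chow_hilbert_flag : chow_hilbert M G flag_hilbert.
Proof. by move=> d; rewrite -[nth _ _ _]/(flag_hilbert`_d) flag_hilbertE; apply: chow_dim_flag. Qed.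

(** In these low degrees none of the bounds [i < a], [j <= 3], [k <= 3] excludes a monomial, so all
    monomials of degree [d] in three variables count, together with one power for each
    hyperplane. *)
Lemma card_chow_basis d : (0 < d < 4)%N -> (3 < a)%N ->
  #|chow_basis d| = (N + 'C(d + 2, 2))%N.
Proof.
move=> /andP[d_gt0 d_lt4] a_gt3.
rewrite -sum1dep_card big_sumType /= addnC; congr (_ + _)%N.
  rewrite (eq_bigl xpredT) => [|f]; first by rewrite sum1_card card_ord.
  by move: d_gt0 d_lt4 a_gt3; clear; lia.
rewrite (eq_bigl (fun p : 'I_4 * 'I_4 => p.1 + p.2 <= d)%N); last first.
  by case=> j k /=; move: d_lt4 a_gt3; clear; lia.
rewrite big_mkcond.
rewrite -(pair_big xpredT xpredT (fun j k : 'I_4 => if j + k <= d then 1 else 0))%N /=.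
by move: d d_gt0 d_lt4 => [|[|[|[|]]]] // _ _; rewrite !big_ord_recl !big_ord0.
Qed.

Lemma flag_hilbert_not_log_concave : (3 < a)%N -> (6 < N)%N ->
  ~ log_concave flag_hilbert.
Proof.
move=> a_gt3 N_gt6 lc.
have h1 : nth 0%N flag_hilbert 1 = (N + 3)%N.
  by rewrite -[nth _ _ _]/(flag_hilbert`_1) flag_hilbertE card_chow_basis.
have h2 : nth 0%N flag_hilbert 2 = (N + 6)%N.
  by rewrite -[nth _ _ _]/(flag_hilbert`_2) flag_hilbertE card_chow_basis.
have h3 : nth 0%N flag_hilbert 3 = (N + 10)%N.
  by rewrite -[nth _ _ _]/(flag_hilbert`_3) flag_hilbertE card_chow_basis.
(* The nonzero coefficient in degree 3 places index 2 in the interior range of [log_concave]. *)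
have sz : (3 < size flag_hilbert)%N.
  by rewrite ltnNge; apply/negP => /(nth_default 0%N); rewrite h3 addnS.
have := lc 2 isT; rewrite h1 h2 h3 => /(_ _).
have -> : (2 < (size flag_hilbert).-1)%N by move: sz; clear; lia.
by move=> /(_ isT); move: N_gt6; clear; nia.
Qed.

Lemma chow_flag_not_log_concave : (3 < a)%N -> (6 < N)%N ->
  exists h : {poly nat}, chow_hilbert M G h /\ ~ log_concave h.
Proof.
move=> a_gt3 N_gt6; exists flag_hilbert; split; first exact: chow_hilbert_flag.
exact: flag_hilbert_not_log_concave.
Qed.

End FlagAndHyperplanes.

(** * Building sets on Boolean matroids *)

Section BooleanBuilding.

Variable n : nat.
Local Notation U := (boolean_matroid n).
Implicit Types (A B F H K : {set 'I_n}) (G : {set {set 'I_n}}).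

Lemma boolean_flat F : flat U F.
Proof. by apply/forallP => e; apply/implyP => eF /=; rewrite cardsU1 eF. Qed.

Lemma boolean_span A : span U A = A.
Proof. exact/span_flat/boolean_flat. Qed.

Section UnionClosed.

Variable G : {set {set 'I_n}}.
Hypotheses (G0 : set0 \notin G) (G1 : forall e, [set e] \in G).
Hypothesis GU : {in G &, forall A B, A :&: B != set0 -> A :|: B \in G}.

Local Notation mx F := (maximal_elts (restrict_le G F)).

Lemma maximal_eltsP F H : H \in mx F ->
  [/\ H \in G, H \subset F
    & forall H', H' \in G -> H' \subset F -> H \subset H' -> H' = H].
Proof.
rewrite inE => /andP[]; rewrite inE => /andP[HG HF] /forallP max; split => //.
move=> H' H'G H'F sH; have := max H'; rewrite inE H'G H'F sH /=.
by move/eqP.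
Qed.

Lemma maximal_elts_inj F H H' e :
  H \in mx F -> H' \in mx F -> e \in H -> e \in H' -> H = H'.
Proof.
move=> /maximal_eltsP[HG HF max] /maximal_eltsP[HG' HF' max'] eH eH'.
have UG : H :|: H' \in G.
  by apply: GU => //; apply/set0Pn; exists e; rewrite inE eH.
have UF : H :|: H' \subset F by rewrite subUset HF.
by rewrite -(max _ UG UF (subsetUl _ _)) -[RHS](max' _ UG UF (subsetUr _ _)).
Qed.

Lemma maximal_elts_cover F e : e \in F -> exists2 H, H \in mx F & e \in H.
Proof.
move=> eF; pose Q H := (H \in restrict_le G F) && (e \in H).
have Q1 : Q [set e] by rewrite /Q !inE G1 sub1set eF eqxx.
case: (arg_maxnP (fun H : {set 'I_n} => #|H|) Q1) => H /andP[HF eH] max.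
exists H => //; rewrite inE HF; apply/forallP => H'; apply/implyP => H'F.
apply/implyP => sH; rewrite eq_sym eqEcard sH; apply: max.
by rewrite /Q H'F (subsetP sH).
Qed.

Section Join.

Variable F : {set 'I_n}.

Lemma bigcup_factorI (u : interval_prod U G F) (H : factor G F) :
  (\bigcup_H' val (u H')) :&: val H = val (u H).
Proof.
apply/setP => e; rewrite inE; apply/andP/idP => [[/bigcupP[H' _ eu] eH]|eu].
  have eH' : e \in val H' by apply: subsetP eu; have /andP[] := valP (u H').
  have eqH : val H' = val H := maximal_elts_inj (valP H') (valP H) eH' eH.
  by move/val_inj: eqH eu => ->.
split; first by apply/bigcupP; exists H.
by apply: subsetP eu; have /andP[] := valP (u H).
Qed.

Lemma restrict_subproof K (H : factor G F) : below U (val H) (K :&: val H).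
Proof. by rewrite /below boolean_flat subsetIr. Qed.

Definition restrict_map (K : interval U F) : interval_prod U G F :=
  [ffun H : factor G F =>
    (exist _ (val K :&: val H) (restrict_subproof (val K) H) : interval U (val H))].

Lemma boolean_join_iso (fF : flat U F) :
  lattice_iso (@le_interval_prod _ U G F) (@le_interval _ U F) (join_map fF).
Proof.
split=> [|u v].
  exists restrict_map => [u|K].
    apply/ffunP => H; rewrite ffunE; apply: val_inj => /=.
    by rewrite boolean_span bigcup_factorI.
  apply: val_inj => /=; rewrite boolean_span; apply/setP => e.
  apply/bigcupP/idP => [[H _]|eK]; first by rewrite ffunE inE => /andP[].
  have eF : e \in F by apply: subsetP eK; have /andP[] := valP K.
  have [H HF eH] := maximal_elts_cover eF.
  by exists (exist _ H HF); rewrite // ffunE inE eK.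
rewrite /le_interval /= !boolean_span; apply/idP/forallP => [suv H|suv].
  by rewrite /le_interval -!bigcup_factorI setSI.
apply/bigcupsP => H _; have /subset_trans := suv H; apply.
exact: (bigcup_sup H).
Qed.

End Join.

(** Overlapping maximal members would have a larger union in [G], and the singletons cover, so the
    maximal members below [F] partition [F]. Subsets of [F] then correspond to families of subsets
    of the blocks, by intersecting with each block, and ranks add as cardinalities. *)
Lemma boolean_building_set : building_set U G.
Proof.
split=> [H HG|F fF|F _].
- by split; [exact: boolean_flat | apply: contraTneq HG => ->].
- exact: boolean_join_iso.
apply: card_partition; apply/and3P; split.
- apply/eqP/setP => e; apply/bigcupP/idP => [[H /maximal_eltsP[_ /subsetP sHF _] /sHF]//|].
  by case/maximal_elts_cover => H; exists H.
- apply/trivIsetP => H H' HF HF'; apply: contraR => /pred0Pn[e /andP[eH eH']].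
  exact/eqP/(maximal_elts_inj HF HF' eH eH').
- by apply/negP => /maximal_eltsP[]; rewrite (negbTE G0).
Qed.

End UnionClosed.

End BooleanBuilding.

(** * The Boolean example *)

Section BooleanExample.

Variable n : nat.
Hypothesis n_ge13 : 13 <= n.
Local Notation U := (boolean_matroid n).
Local Notation a := (n - 6).

Definition bool_R (m : nat) : {set 'I_n} := [set i : 'I_n | i < m].

Lemma bool_P_subproof : 7 <= n. Proof. exact: leq_trans n_ge13. Qed.

(** The bound 13 is 6 + 7: with [a = n - 6] the set [bool_R a] has at least seven points, so it
    contains all seven omitted points and no [bool_P f] contains it. *)
Definition bool_P (f : 'I_7) : {set 'I_n} := [set~ widen_ord bool_P_subproof f].

Definition bool_G : {set {set 'I_n}} :=
  [set [set e] | e : 'I_n] :|: [set bool_R a; bool_R (a + 3); setT]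
    :|: [set bool_P f | f : 'I_7].

Lemma card_bool_R m : m <= n -> #|bool_R m| = m.
Proof.
by move=> le_m; rewrite -sum1dep_card (big_ord_narrow le_m) sum1_card card_ord.
Qed.

Lemma bool_P_setU f A : bool_P f :|: A \in bool_G.
Proof.
have [fA|nfA] := boolP (widen_ord bool_P_subproof f \in A).
  rewrite (_ : _ :|: _ = setT) ?inE ?eqxx ?orbT //.
  by apply/setP => e; rewrite !inE; case: eqP => // ->; rewrite fA.
rewrite (setUidPl _); first by rewrite inE imset_f ?orbT.
by apply/subsetP => e eA; rewrite !inE; apply: contraNneq nfA => <-.
Qed.

Lemma bool_R_sub m m' : m <= m' -> bool_R m \subset bool_R m'.
Proof. by move=> le_m; apply/subsetP => i; rewrite !inE => /leq_trans; apply. Qed.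

(** A union with the complement of a point is that complement or the whole set; an atom meeting a
    set is contained in it; and the flag is a chain. *)
Lemma bool_G_setU : {in bool_G &, forall A B, A :&: B != set0 -> A :|: B \in bool_G}.
Proof.
have sub A B : A \in bool_G -> B \in bool_G -> (A \subset B) || (B \subset A) ->
    A :|: B \in bool_G.
  by move=> AG BG /orP[/setUidPr->|/setUidPl->].
have s1 e A : [set e] :&: A != set0 -> [set e] \subset A.
  by case/set0Pn => x; rewrite !inE sub1set => /andP[/eqP->].
move=> A B AG BG AB.
case/setUP: (AG) => [hA|/imsetP[f _ ->]]; last exact: bool_P_setU.
case/setUP: (BG) => [hB|/imsetP[f _ ->]]; last by rewrite setUC bool_P_setU.
case/setUP: hA => [/imsetP[e _ eA]|hA].
  by apply: sub => //; rewrite eA s1 // -eA.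
case/setUP: hB => [/imsetP[e _ eB]|hB].
  by apply: sub => //; rewrite eB s1 ?orbT // -eB setIC.
have le3 : bool_R a \subset bool_R (a + 3) by apply: bool_R_sub; rewrite leq_addr.
apply: sub => //; move: hA hB; rewrite !inE.
by do 2![case/orP => [/orP[]|] /eqP->]; rewrite ?subxx ?subsetT ?le3 ?orbT.
Qed.

Lemma bool_G_building : building_set U bool_G.
Proof.
apply: boolean_building_set => [|e|]; last exact: bool_G_setU.
  rewrite !inE; apply/negP => /orP[/orP[/imsetP[e _ /esym/eqP]|]|].
  - by rewrite -cards_eq0 cards1.
  - case/orP => [/orP[]|]; rewrite eq_sym -cards_eq0 ?cardsT ?card_ord ?card_bool_R; lia.
  case/imsetP => f _ /esym/eqP; rewrite -cards_eq0.
  by rewrite cardsC1 card_ord; lia.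
by rewrite !inE imset_f.
Qed.

Lemma boolean_example : exists (G : {set {set 'I_n}}) (h : {poly nat}),
  [/\ building_set U G, chow_hilbert U G h & ~ log_concave h].
Proof.
have n_ge := n_ge13.
have loopU : loopless U := boolean_flat set0.
have rk1 : U (bool_R a) = a by apply: card_bool_R; lia.
have rk2 : U (bool_R (a + 3)) = a + 3 by apply: card_bool_R; lia.
have rkT : U setT = a + 6 by rewrite /= cardsT card_ord; lia.
have rkP f : U (bool_P f) = a + 5 by rewrite /= cardsC1 card_ord; lia.
have sR : bool_R a \subset bool_R (a + 3) by apply: bool_R_sub; lia.
have nRP f : ~~ (bool_R a \subset bool_P f).
  apply/subsetPn; exists (widen_ord bool_P_subproof f); rewrite !inE ?eqxx //=.
  by have := ltn_ord f; lia.
have injP : injective bool_P.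
  move=> f f' /(congr1 (@setC _)); rewrite !setCK => /set1_inj/(congr1 val) /=.
  exact: val_inj.
have [] := chow_flag_not_log_concave _ loopU (fun e => boolean_flat [set e])
  (boolean_flat _) (boolean_flat _) (fun f => boolean_flat (bool_P f)) rk1 rk2 rkT rkP
  sR nRP injP (erefl bool_G); try lia.
by move=> h [ch lc]; exists bool_G, h; split => //; apply: bool_G_building.
Qed.

End BooleanExample.

(** * Decomposable intervals, separations and coloops *)

Section Decomposable.

Variables (E : finType) (M : matroid E).
Implicit Types (A B F H K : {set E}).

Lemma flat_rk_setU1 F A e : flat M F -> A \subset F -> e \notin F ->
  M A < M (e |: A).
Proof.
move=> /forallP/(_ e) fF sAF eF; rewrite eF /= in fF.
have := rk_submod M (e |: A) F.
have -> : (e |: A) :|: F = e |: F by rewrite -setUA (setUidPr sAF).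
have := rkS M (_ : A \subset (e |: A) :&: F); rewrite subsetI sAF subsetUr.
by move=> /(_ isT); move: fF; clear; lia.
Qed.

Section Rank.

Hypotheses (loopM : loopless M) (flat_set1 : forall e, flat M [set e]).
Variable F : {set E}.
Hypothesis fF : flat M F.

(** Under the isomorphism with [L1 * L2], the flats [A] and [B] correspond to the pairs (top,
    bottom) and (bottom, top). Intersecting a flat with [A] or [B] keeps one coordinate and sends
    the other to the bottom. *)
Lemma decomposable_separation : lattice_decomposable M F ->
  exists A B, [/\ flat M A /\ flat M B, A != set0 /\ B != set0, A :|: B = F,
    A :&: B = set0 & forall A' B', flat M A' -> flat M B' -> A' \subset A -> B' \subset B ->
        flat M (A' :|: B')].
Proof.
case=> d1 [d2 [L1 [L2 [f [nt1 nt2 [[g fK gK] le_f]]]]]].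
have b0 : below M F set0 by apply/andP; split; [exact: loopM | exact: sub0set].
have bF : below M F F by rewrite /below fF subxx.
pose bot : interval M F := exist _ set0 b0.
pose top : interval M F := exist _ F bF.
case eb : (f bot) => [b1 b2]; case et : (f top) => [t1 t2].
have le_g u v : le_interval (g u) (g v) = (u.1 <= v.1)%O && (u.2 <= v.2)%O.
  by rewrite -le_f !gK.
(* The bounds of [L1] and [L2] are read off from the images of the empty flat and of [F]. *)
have ge_b x y : (b1 <= x)%O && (b2 <= y)%O.
  have := le_f bot (g (x, y)); rewrite gK eb /= => ->.
  by rewrite /le_interval sub0set.
have le_t x y : (x <= t1)%O && (y <= t2)%O.
  have := le_f (g (x, y)) top; rewrite gK et /= => ->.
  by rewrite /le_interval; have /andP[] := valP (g (x, y)).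
have [ge_b1 ge_b2] : (forall x, (b1 <= x)%O) /\ (forall y, (b2 <= y)%O).
  by split=> [x|y]; [have /andP[] := ge_b x b2 | have /andP[] := ge_b b1 y].
have [le_t1 le_t2] : (forall x, (x <= t1)%O) /\ (forall y, (y <= t2)%O).
  by split=> [x|y]; [have /andP[] := le_t x b2 | have /andP[] := le_t b1 y].
have gb : val (g (b1, b2)) = set0 by rewrite -eb fK.
have g0 x y : val (g (x, y)) = set0 -> x = b1 /\ y = b2.
  move=> e0; have : g (x, y) = bot by apply: val_inj; rewrite e0.
  by move/(congr1 f); rewrite gK eb => -[].
pose A := val (g (t1, b2)); pose B := val (g (b1, t2)).
have flat_g u : flat M (val (g u)) by have /andP[] := valP (g u).
have sub_g u : val (g u) \subset F by have /andP[] := valP (g u).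
have subg u v : (val (g u) \subset val (g v)) = (u.1 <= v.1)%O && (u.2 <= v.2)%O.
  exact: le_g.
have below_g K : flat M K -> K \subset F -> exists u, K = val (g u).
  move=> fKl sKF; have bK : below M F K by rewrite /below fKl sKF.
  by exists (f (exist _ K bK)); rewrite fK.
have capA x y : val (g (x, y)) :&: A = val (g (x, b2)).
  apply/eqP; rewrite eqEsubset subsetI !subg /= !lexx ge_b2 le_t1 /= andbT.
  have [u eu] := below_g (val (g (x, y)) :&: A)
    (flatI (flat_g (x, y)) (flat_g (t1, b2))) (subset_trans (subsetIl _ _) (sub_g _)).
  have := subsetIl (val (g (x, y))) A; have := subsetIr (val (g (x, y))) A.
  by rewrite eu !subg /= => /andP[_ ->] /andP[-> _].
have capB x y : val (g (x, y)) :&: B = val (g (b1, y)).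
  apply/eqP; rewrite eqEsubset subsetI !subg /= !lexx ge_b1 le_t2 /= andbT.
  have [u eu] := below_g (val (g (x, y)) :&: B)
    (flatI (flat_g (x, y)) (flat_g (b1, t2))) (subset_trans (subsetIl _ _) (sub_g _)).
  have := subsetIl (val (g (x, y))) B; have := subsetIr (val (g (x, y))) B.
  by rewrite eu !subg /= => /andP[-> _] /andP[_ ->].
have AB0 : A :&: B = set0 by rewrite capB.
(* A singleton flat outside both [A] and [B] would have both coordinates at the bottom, hence be
   empty. *)
have ABF : A :|: B = F.
  apply/eqP; rewrite eqEsubset subUset !sub_g /=; apply/subsetP => e eF.
  have [|[x y] exy] := below_g [set e] (flat_set1 e); first by rewrite sub1set.
  rewrite inE; apply: contraT; rewrite negb_or => /andP[eA eB].
  have disj (C : {set E}) : e \notin C -> [set e] :&: C = set0.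
    by move=> eC; apply/setP => z; rewrite !inE; case: eqP => // ->; rewrite (negbTE eC).
  have /g0[ex _] : val (g (x, b2)) = set0 by rewrite -(capA x y) -exy disj.
  have /g0[_ ey] : val (g (b1, y)) = set0 by rewrite -(capB x y) -exy disj.
  have : [set e] = set0 by rewrite exy ex ey.
  by move/setP/(_ e); rewrite !inE eqxx.
exists A, B; split => //; first by split; apply: flat_g.
  split; apply/eqP.
    move=> /g0[e1 _]; case: nt1 => x [y]; case.
    have eqb z : z = b1 by apply: le_anti; rewrite ge_b1 -e1 le_t1.
    by rewrite (eqb x) (eqb y).
  move=> /g0[_ e2]; case: nt2 => x [y]; case.
  have eqb z : z = b2 by apply: le_anti; rewrite ge_b2 -e2 le_t2.
  by rewrite (eqb x) (eqb y).
move=> A' B' fA' fB' sA' sB'.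
have [[x y] eA'] := below_g A' fA' (subset_trans sA' (sub_g _)).
have [[x' y'] eB'] := below_g B' fB' (subset_trans sB' (sub_g _)).
suff -> : A' :|: B' = val (g (x, y')) by exact: flat_g.
have -> : val (g (x, y')) = val (g (x, y')) :&: (A :|: B).
  by rewrite ABF; apply/esym/setIidPl.
rewrite setIUr capA capB.
by rewrite -(capA x y) -(capB x' y') -eA' -eB' (setIidPl sA') (setIidPl sB').
Qed.

(** Take a largest flat [A'] inside [A] with [M A' + M B <= M (A' :|: B)]. If it were proper, adding
    an element and closing up would raise [M A'] by at most 1, while [M (A' :|: B)] strictly
    increases because [A' :|: B] is a flat; this contradicts maximality. *)
Lemma decomposable_rank : lattice_decomposable M F ->
  exists A, [/\ A \subset F, A != set0, A != F & M A + M (F :\: A) <= M F].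
Proof.
case/decomposable_separation => A [B [[fA fB] [A0 B0] ABF AB0 flatU]].
have eB : F :\: A = B.
  apply/setP => e; have /setP/(_ e) := AB0; rewrite -ABF !inE.
  by case: (e \in A).
exists A; split => //; first by rewrite -ABF subsetUl.
  by apply: contraNneq B0 => eA; rewrite -eB eA setDv.
rewrite eB; pose Q A' := [&& flat M A', A' \subset A & M A' + M B <= M (A' :|: B)].
have Q0 : Q set0.
  apply/and3P; split; [exact: loopM | exact: sub0set |].
  by rewrite rk0 set0U.
case: (arg_maxnP (fun A' : {set E} => #|A'|) Q0) => A' /and3P[fA' sA' le_A'] max.
have [eAA|neA] := eqVneq A' A; first by move: le_A'; rewrite eAA ABF.
have /properP[_ [e eA neA']] : A' \proper A by rewrite properEneq neA.
have sA'' : span M (e |: A') \subset A.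
  by apply: span_min => //; rewrite subUset sub1set eA.
have eA'' : e |: A' \subset span M (e |: A') by apply: sub_span.
have : Q (span M (e |: A')).
  apply/and3P; split=> //; first exact: flat_span.
  have le1 : M (span M (e |: A')) <= M A' + 1.
    by rewrite rk_span setUC -(cards1 e) rk_setU_card.
  have lt2 : M (A' :|: B) < M (span M (e |: A') :|: B).
    apply: flat_rk_lt; first exact: flatU.
    apply/properP; split.
      by apply/setSU/(subset_trans _ eA'')/subsetUr.
    exists e; first by rewrite inE (subsetP eA'') // !inE eqxx.
    rewrite inE negb_or neA' /=; apply/negP => eB'.
    by have /setP/(_ e) := AB0; rewrite !inE eA eB'.
  by move: le1 lt2 le_A'; clear; lia.
move/max => /= le_c; suff /proper_card : A' \proper span M (e |: A').
  by rewrite ltnNge le_c.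
apply/properP; split; first exact: subset_trans (subsetUr _ _) eA''.
by exists e; rewrite // (subsetP eA'') // !inE eqxx.
Qed.

End Rank.

(** * The lattice structure on the flats below a flat *)

Section FlatsLattice.

Variables (F : {set E}) (fF : flat M F).

(* The proof argument keys the lattice structure: joins stay below [F] only
   because [F] is a flat. *)
Definition flats_below of flat M F : Type := {H : {set E} | below M F H}.
Local Notation L := (flats_below fF).

HB.instance Definition _ := Choice.on L.

Definition le_flats : rel L := fun x y => sval x \subset sval y.

Lemma le_flats_refl : reflexive le_flats.
Proof. by move=> x; apply: subxx. Qed.
Lemma le_flats_anti : antisymmetric le_flats.
Proof. by move=> x y le_xy; apply/val_inj/eqP; rewrite eqEsubset. Qed.
Lemma le_flats_trans : transitive le_flats.
Proof. by move=> x y z; apply: subset_trans. Qed.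

Fact flats_display : Order.disp_t. Proof. exact: Order.Disp tt tt. Qed.

HB.instance Definition _ := Order.Le_isPOrder.Build flats_display L
  le_flats_refl le_flats_anti le_flats_trans.

Lemma meet_subproof (x y : L) : below M F (sval x :&: sval y).
Proof.
case: x y => H /= /andP[fH sH] [K /= /andP[fK _]].
by rewrite /below flatI // subIset ?sH.
Qed.

Lemma join_subproof (x y : L) : below M F (span M (sval x :|: sval y)).
Proof.
case: x y => H /= /andP[fH sH] [K /= /andP[fK sK]].
by rewrite /below flat_span span_min // subUset sH.
Qed.

Definition meet_flats (x y : L) : L :=
  exist (fun H => below M F H) _ (meet_subproof x y).
Definition join_flats (x y : L) : L :=
  exist (fun H => below M F H) _ (join_subproof x y).

Lemma meet_flatsP (x y z : L) :
  (x <= meet_flats y z)%O = (x <= y)%O && (x <= z)%O.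
Proof. exact: subsetI. Qed.

Lemma join_flatsP (x y z : L) :
  (join_flats x y <= z)%O = (x <= z)%O && (y <= z)%O.
Proof.
rewrite /Order.le /= /le_flats /= -subUset; apply/idP/idP.
  exact/subset_trans/sub_span.
by apply: span_min; have /andP[] := svalP z.
Qed.

HB.instance Definition _ := Order.POrder_MeetJoin_isLattice.Build flats_display L
  meet_flatsP join_flatsP.

End FlatsLattice.

Section Coloop.

Variables (F : {set E}) (e : E).
Hypotheses (loopM : loopless M) (fF : flat M F) (eF : e \in F) (neF : F != [set e]).
Hypothesis coloop : M (F :\ e) < M F.

Lemma coloop_rk A : A \subset F :\ e -> M A < M (e |: A).
Proof.
move=> sA; have eA : e \notin A.
  by apply/negP => /(subsetP sA); rewrite !inE eqxx.
have := rk_submod M (e |: A) (F :\ e).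
have -> : (e |: A) :|: (F :\ e) = F.
  by rewrite -setUA (setUidPr sA) setD1K.
have := rkS M (_ : A \subset (e |: A) :&: (F :\ e)).
by rewrite subsetI sA subsetUr => /(_ isT); move: coloop; clear; lia.
Qed.

Lemma coloop_flatD : flat M (F :\ e).
Proof.
apply/forallP => x; apply/implyP; rewrite !inE negb_and negbK.
case/orP => [/eqP ->|xF]; first exact: coloop_rk.
by apply: flat_rk_setU1 fF _ xF; apply: subsetDl.
Qed.

Lemma coloop_flatU K : flat M K -> K \subset F :\ e -> flat M (e |: K).
Proof.
move=> fK sK; have sKF : K \subset F := subset_trans sK (subsetDl _ _).
apply/forallP => x; apply/implyP; rewrite !inE negb_or => /andP[xe xK].
have [xF|xF] := boolP (x \in F); last first.
  by apply: flat_rk_setU1 fF _ xF; rewrite subUset sub1set eF.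
have := @coloop_rk (x |: K); rewrite subUset sub1set !inE xe xF => /(_ sK).
have /forallP/(_ x) := fK; rewrite xK /=.
have := rk_setU_card M K [set e]; rewrite cards1 [K :|: _]setUC.
by rewrite setUCA; clear; lia.
Qed.

(** A coloop [e] can be added to or removed from any flat below [F], so the interval is the product
    of the flats below [F :\ e] with a two-element chain recording whether [e] is present. *)
Lemma coloop_decomposable : lattice_decomposable M F.
Proof.
pose L := flats_below coloop_flatD.
have to_sub (K : interval M F) : below M (F :\ e) (val K :&: (F :\ e)).
  by have /andP[fK _] := valP K; rewrite /below flatI ?coloop_flatD ?subsetIr.
have from_sub (K : L) (b : bool) : below M F (if b then e |: val K else val K).
  have /andP[fK sK] := valP K; have sKF := subset_trans sK (subsetDl _ _).
  by case: b; rewrite /below ?coloop_flatU ?subUset ?sub1set ?eF ?fK.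
pose f (K : interval M F) : L * bool := (exist (fun H => below M (F :\ e) H) _ (to_sub K), e \in val K).
pose g (u : L * bool) : interval M F :=
  exist (fun H => below M F H) _ (from_sub u.1 u.2).
exists flats_display, _, L, bool, f; split.
(* The first factor is nontrivial because [F != [set e]] makes the empty flat and [F :\ e]
   distinct. *)
- have b0 : below M (F :\ e) set0 by apply/andP; split; [exact: loopM | exact: sub0set].
  have bF : below M (F :\ e) (F :\ e) by rewrite /below coloop_flatD subxx.
  exists (exist (fun H => below M (F :\ e) H) _ b0),
    (exist (fun H => below M (F :\ e) H) _ bF) => /(congr1 val) /= e0.
  by move: neF; rewrite -(setD1K eF) -e0 setU0 eqxx.
- by exists true, false.
split.
  exists g => [K|[K b]].
    apply: val_inj => /=; have /andP[_ sK] := valP K.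
    apply/setP => x; have := subsetP sK x; case: ifP => [eK|neK]; rewrite !inE.
      by case: eqP => [->|_ /=]; rewrite ?eK //=; case: (x \in val K) => // ->.
    case: eqP => [->|_ /=]; first by rewrite neK.
    by case: (x \in val K) => // ->.
  have /andP[_ sK] := valP K; have neK : e \notin val K.
    by apply/negP => /(subsetP sK); rewrite !inE eqxx.
  congr pair.
    apply: val_inj => /=; apply/setP => x; have := subsetP sK x.
    by case: b; rewrite !inE; case: eqP => [->|_] //=; rewrite ?(negbTE neK) //;
      case: (x \in val K) => // ->.
  by case: b; rewrite /= ?inE ?eqxx ?(negbTE neK).
move=> K K'; rewrite /le_interval /= leEbool.
have /andP[_ sK] := valP K.
apply/andP/idP => [[sKK' he]|sKK'].
  apply/subsetP => x xK; have [xe|ne] := eqVneq x e.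
    by move: he; rewrite -xe xK; case: (x \in val K').
  have /subsetP/(_ x) := sKK'; rewrite !inE ne xK (subsetP sK) // => /(_ isT).
  by case/andP.
split; first exact: setSI.
by case: (boolP (e \in val K)) => // /(subsetP sKK') ->.
Qed.

End Coloop.

End Decomposable.

(** * A laminar matroid with seven circuit-hyperplanes *)

Section ConcreteMatroid.

Local Notation E := ('I_5 + 'I_4 + 'I_7 * 'I_10)%type.
Implicit Types (A B F K : {set E}) (e : E) (f : 'I_7).

Definition blk1 : {set E} := [set e | if e is inl (inl _) then true else false].
Definition blk2 : {set E} := [set e | if e is inl (inr _) then true else false].
Definition blk3 : {set E} := [set e | if e is inr _ then true else false].
Definition ccirc f : {set E} := [set e | if e is inr (g, _) then g == f else false].

Local Notation p A := #|A :&: blk1|.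
Local Notation q A := #|A :&: blk2|.
Local Notation s A := #|A :&: blk3|.

(** The nested minima impose the capacities 4, 7 and 10 from the inside out. Each block is larger
    than the rank it adds (5 > 4, 4 > 3, 70 > 3), which keeps the flag members free of coloops. *)
Definition laminar_rk A : nat := minn 10 (minn 7 (minn 4 (p A) + q A) + s A).

Definition is_circ A : bool := [exists f, A == ccirc f].

(** The boolean is subtracted as 0 or 1: each of the seven disjoint bases [ccirc f] drops from rank
    10 to rank 9, and no other set changes. *)
Definition circ_rk A : nat := laminar_rk A - is_circ A.

Lemma card_blk1 : #|blk1| = 5.
Proof.
have inj : injective (fun i : 'I_5 => inl (inl i) : E) by move=> i j [].
rewrite -[RHS](card_ord 5) -(card_imset predT inj).
apply: eq_card => e; rewrite inE; apply/idP/imsetP => [|[i _ ->]//].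
by case: e => [[i|]|] // _; exists i.
Qed.

Lemma card_blk2 : #|blk2| = 4.
Proof.
have inj : injective (fun i : 'I_4 => inl (inr i) : E) by move=> i j [].
rewrite -[RHS](card_ord 4) -(card_imset predT inj).
apply: eq_card => e; rewrite inE; apply/idP/imsetP => [|[i _ ->]//].
by case: e => [[|i]|] // _; exists i.
Qed.

Lemma card_blk3 : #|blk3| = 70.
Proof.
have inj : injective (fun i : 'I_7 * 'I_10 => inr i : E) by move=> i j [].
transitivity #|{: 'I_7 * 'I_10}|; last by rewrite card_prod !card_ord.
rewrite -(card_imset predT inj).
apply: eq_card => e; rewrite inE; apply/idP/imsetP => [|[i _ ->]//].
by case: e => [[]|i] // _; exists i.
Qed.

Lemma card_ccirc f : #|ccirc f| = 10.
Proof.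
have inj : injective (fun i : 'I_10 => inr (f, i) : E) by move=> i j [].
rewrite -[RHS](card_ord 10) -(card_imset predT inj).
apply: eq_card => e; rewrite inE; apply/idP/imsetP => [|[i _ ->]//].
by case: e => [[]|[g i]] //= /eqP->; exists i.
Qed.

Lemma blk_cases e :
  [|| [&& e \in blk1, e \notin blk2 & e \notin blk3],
      [&& e \notin blk1, e \in blk2 & e \notin blk3]
    | [&& e \notin blk1, e \notin blk2 & e \in blk3]].
Proof. by rewrite !inE; case: e => [[]|]. Qed.

Lemma card_blocks A : #|A| = p A + q A + s A.
Proof.
rewrite -(cardsID blk1 A) -addnA; congr (_ + _).
rewrite -(cardsID blk2 (A :\: blk1)); congr (_ + _); apply: eq_card => e;
by have := blk_cases e; rewrite !inE; case: e => [[]|] x _; case: (_ \in A).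
Qed.

Lemma ccirc_sub f : ccirc f \subset blk3.
Proof. by apply/subsetP => e; rewrite !inE; case: e => [[]|]. Qed.

Lemma sub_blk3 A : A \subset blk3 -> [/\ p A = 0, q A = 0 & s A = #|A|].
Proof.
move=> sA; have eA : s A = #|A| by rewrite (setIidPl sA).
by have := card_blocks A; split; lia.
Qed.

Lemma is_circP A : is_circ A -> exists f, A = ccirc f.
Proof. by case/existsP => f /eqP; exists f. Qed.

Lemma is_circ_ccirc f : is_circ (ccirc f).
Proof. by apply/existsP; exists f. Qed.

Lemma is_circ_num A : is_circ A -> [/\ p A = 0, q A = 0 & s A = 10].
Proof.
by case/is_circP => f ->; case: (sub_blk3 (ccirc_sub f)); rewrite card_ccirc.
Qed.

Lemma circ_rk_le A : circ_rk A <= laminar_rk A. Proof. exact: leq_subr. Qed.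

(** Values of a set function at [A], [B], their union and their intersection. Monotonicity is
    bundled with submodularity because truncation by [minn] preserves submodularity only together
    with it. *)
Definition submod4 (x y u i : nat) : Prop :=
  [/\ i <= x, i <= y, x <= u, y <= u & u + i <= x + y].

Lemma submod4_min c x y u i :
  submod4 x y u i -> submod4 (minn c x) (minn c y) (minn c u) (minn c i).
Proof. by case=> *; split; lia. Qed.

Lemma submod4_add x y u i x' y' u' i' : submod4 x y u i -> submod4 x' y' u' i' ->
  submod4 (x + x') (y + y') (u + u') (i + i').
Proof. by case=> ? ? ? ? ? [*]; split; lia. Qed.

Lemma submod4_card (X A B : {set E}) :
  submod4 #|A :&: X| #|B :&: X| #|(A :|: B) :&: X| #|(A :&: B) :&: X|.
Proof.
split; rewrite ?subset_leq_card ?setSI ?subsetIl ?subsetIr ?subsetUl ?subsetUr //.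
by rewrite setIUl [(A :&: B) :&: X]setIIl cardsUI.
Qed.

Lemma submod4_laminar_rk A B :
  submod4 (laminar_rk A) (laminar_rk B) (laminar_rk (A :|: B)) (laminar_rk (A :&: B)).
Proof.
apply/submod4_min/submod4_add; last exact: submod4_card.
apply/submod4_min/submod4_add; last exact: submod4_card.
exact/submod4_min/submod4_card.
Qed.

Lemma circ_rk0 : circ_rk set0 = 0.
Proof. by have := circ_rk_le set0; rewrite /laminar_rk !set0I !cards0; lia. Qed.

Lemma laminar_rk_card A : laminar_rk A <= #|A|.
Proof. by rewrite card_blocks /laminar_rk; lia. Qed.

Lemma circ_rk_card A : circ_rk A <= #|A|.
Proof. exact: leq_trans (circ_rk_le A) (laminar_rk_card A). Qed.

Lemma circ_rk_ccirc f : circ_rk (ccirc f) = 9.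
Proof.
rewrite /circ_rk is_circ_ccirc /laminar_rk.
by case: (is_circ_num (is_circ_ccirc f)) => -> -> ->.
Qed.

Lemma circ_rk_notcirc A : ~~ is_circ A -> circ_rk A = laminar_rk A.
Proof. by move/negbTE => h; rewrite /circ_rk h subn0. Qed.

Lemma circ_rkS A B : A \subset B -> circ_rk A <= circ_rk B.
Proof.
move=> sAB; have [->//|neq] := eqVneq A B.
have [cB|ncB] := boolP (is_circ B); last first.
  rewrite (circ_rk_notcirc ncB) (leq_trans (circ_rk_le A)) //.
  by have [_ _] := submod4_laminar_rk A B; rewrite (setUidPr sAB).
have : #|A| < #|B| by rewrite proper_card // properEneq neq.
have [f ->] := is_circP cB; rewrite circ_rk_ccirc card_ccirc ltnS.
exact: leq_trans (circ_rk_card A).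
Qed.

(** Supplies the unit of slack that pays for the lowered rank of [ccirc f]: in the incomparable case
    the union has rank at most 10 and the intersection at most [circ_rk B - 1], against 9 plus
    [circ_rk B]. If [B] is another circuit, the two are disjoint. *)
Lemma circ_rk_outside f B : ~~ (B \subset ccirc f) -> ~~ (ccirc f \subset B) ->
  #|ccirc f :&: B| < circ_rk B.
Proof.
move=> nBC nCB.
have lt9 : #|ccirc f :&: B| <= 9.
  have : #|ccirc f :&: B| < #|ccirc f|.
    by rewrite proper_card // properE subsetIl subsetI subxx.
  by rewrite card_ccirc.
have [cB|ncB] := boolP (is_circ B).
  have [g eB] := is_circP cB; rewrite eB circ_rk_ccirc.
  suff -> : ccirc f :&: ccirc g = set0 by rewrite cards0.
  apply/setP => e; rewrite !inE; case: e => [[]|[h i]] //=.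
  apply/negbTE/negP => /andP[/eqP-> /eqP efg].
  by rewrite eB efg subxx in nBC.
rewrite circ_rk_notcirc // /laminar_rk.
have le_s : #|ccirc f :&: B| <= s B.
  by rewrite subset_leq_card // setIC setIS // ccirc_sub.
have lt_B : #|ccirc f :&: B| < p B + q B + s B.
  by rewrite -card_blocks proper_card // properE subsetIr subsetI subxx andbT.
by move: lt9 le_s lt_B; clear; lia.
Qed.

Lemma circ_rk_submod A B : circ_rk (A :|: B) + circ_rk (A :&: B) <= circ_rk A + circ_rk B.
Proof.
have circ_submod (C : {set E}) f : circ_rk (ccirc f :|: C) + circ_rk (ccirc f :&: C)
    <= circ_rk (ccirc f) + circ_rk C.
  have [sC|nsC] := boolP (C \subset ccirc f).
    by rewrite (setUidPl sC) (setIidPr sC).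
  have [sC|nsC'] := boolP (ccirc f \subset C).
    by rewrite (setUidPr sC) (setIidPl sC) addnC.
  have := circ_rk_outside nsC nsC'; have := circ_rk_card (ccirc f :&: C).
  have := circ_rk_le (ccirc f :|: C); rewrite circ_rk_ccirc /laminar_rk.
  by clear; lia.
have [/is_circP[f ->]|nA] := boolP (is_circ A); first exact: circ_submod.
have [/is_circP[f ->]|nB] := boolP (is_circ B).
  by rewrite setUC setIC addnC [circ_rk A + _]addnC addnC; apply: circ_submod.
rewrite (circ_rk_notcirc nA) (circ_rk_notcirc nB).
have [_ _ _ _] := submod4_laminar_rk A B; apply: leq_trans.
by rewrite leq_add ?circ_rk_le.
Qed.

Definition circ_matroid : matroid E := Matroid circ_rk0 circ_rkS circ_rk_submod circ_rk_card.

Local Notation M := circ_matroid.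

Lemma circ_rk_num A : [|| p A != 0, q A != 0 | s A != 10] -> circ_rk A = laminar_rk A.
Proof.
move=> h; apply: circ_rk_notcirc; apply/negP => /is_circ_num[p0 q0 s10].
by rewrite p0 q0 s10 in h.
Qed.

Lemma circ_rk_cases A :
  circ_rk A = laminar_rk A \/ [/\ circ_rk A = 9, p A = 0, q A = 0 & s A = 10].
Proof.
have [/[dup] cA /is_circP[f eA]|/circ_rk_notcirc] := boolP (is_circ A); last by left.
by right; case: (is_circ_num cA); split=> //; rewrite eA circ_rk_ccirc.
Qed.

Lemma card_setU1I (X : {set E}) A e : e \notin A ->
  #|(e |: A) :&: X| = (e \in X) + #|A :&: X|.
Proof.
move=> eA; rewrite setIUl; have [eX|neX] := boolP (e \in X).
  rewrite (setIidPl _) ?sub1set // cardsU1 !inE negb_and eA.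
  by [].
rewrite (_ : [set e] :&: X = set0) ?set0U //.
by apply/setP => x; rewrite !inE; case: eqP => // ->; apply: negbTE.
Qed.

Lemma circ_rk_small A : #|A| <= 3 -> circ_rk A = #|A|.
Proof.
rewrite card_blocks => le3; rewrite circ_rk_num; first by rewrite /laminar_rk; lia.
by apply/or3P; apply: Or33; lia.
Qed.

Lemma circ_loopless : loopless M.
Proof.
apply/forallP => e; apply/implyP => _ /=.
by rewrite setU0 !circ_rk_small ?cards1 ?cards0.
Qed.

Lemma circ_flat1 e : flat M [set e].
Proof.
apply/forallP => x; apply/implyP; rewrite inE => ne /=.
by rewrite !circ_rk_small ?cards2 ?cards1 // ?ne.
Qed.

Definition blk12 : {set E} := blk1 :|: blk2.

Lemma num_blk1 : [/\ p blk1 = 5, q blk1 = 0 & s blk1 = 0].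
Proof.
have := card_blocks blk1; rewrite setIid card_blk1.
by split; lia.
Qed.

Lemma num_blk12 : [/\ p blk12 = 5, q blk12 = 4 & s blk12 = 0].
Proof.
split.
- by rewrite (setIidPr _) ?card_blk1 ?subsetUl.
- by rewrite (setIidPr _) ?card_blk2 ?subsetUr.
apply/eqP; rewrite cards_eq0; apply/eqP/setP => e.
by have := blk_cases e; rewrite !inE; case: e => [[]|].
Qed.

Lemma num_T : [/\ p [set: E] = 5, q [set: E] = 4 & s [set: E] = 70].
Proof. by rewrite !setTI card_blk1 card_blk2 card_blk3. Qed.

Lemma circ_rk_blk1 : circ_rk blk1 = 4.
Proof.
by case: num_blk1 => p1 q1 s1; rewrite circ_rk_num ?p1 // /laminar_rk p1 q1 s1.
Qed.

Lemma circ_rk_blk12 : circ_rk blk12 = 7.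
Proof.
by case: num_blk12 => p1 q1 s1; rewrite circ_rk_num ?p1 // /laminar_rk p1 q1 s1.
Qed.

Lemma circ_rk_T : circ_rk [set: E] = 10.
Proof.
by case: num_T => p1 q1 s1; rewrite circ_rk_num ?p1 // /laminar_rk p1 q1 s1.
Qed.

Lemma circ_flat_blk1 : flat M blk1.
Proof.
apply/forallP => e; apply/implyP => ne /=; rewrite circ_rk_blk1.
case: num_blk1 => p1 q1 s1; have := blk_cases e; rewrite (negbTE ne) /=.
rewrite circ_rk_num /laminar_rk ?card_setU1I // ?p1 ?q1 ?s1 ?(negbTE ne) //.
by case: (e \in blk2); case: (e \in blk3).
Qed.

Lemma circ_flat_blk12 : flat M blk12.
Proof.
apply/forallP => e; apply/implyP => ne /=; rewrite circ_rk_blk12.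
case: num_blk12 => p1 q1 s1; have := blk_cases e.
have /norP[n1 n2] : ~~ ((e \in blk1) || (e \in blk2)) by rewrite inE in ne.
rewrite (negbTE n1) (negbTE n2) /= => n3.
by rewrite circ_rk_num /laminar_rk ?card_setU1I // ?p1 ?q1 ?s1 ?(negbTE n1) ?(negbTE n2) ?n3.
Qed.

Lemma circ_flat_ccirc f : flat M (ccirc f).
Proof.
apply/forallP => e; apply/implyP => ne /=; rewrite circ_rk_ccirc.
case: (is_circ_num (is_circ_ccirc f)) => p1 q1 s1.
have P := card_setU1I blk1 ne; have Q := card_setU1I blk2 ne.
have S := card_setU1I blk3 ne; rewrite p1 q1 s1 in P Q S.
have := blk_cases e; rewrite circ_rk_num ?/laminar_rk P Q S.
  by case: (e \in blk1); case: (e \in blk2); case: (e \in blk3).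
by have := blk_cases e; case: (e \in blk1); case: (e \in blk2); case: (e \in blk3).
Qed.

Lemma connected_flat F : flat M F ->
  (forall A, A \subset F -> 0 < #|A| -> 0 < #|F :\: A| ->
     circ_rk F < circ_rk A + circ_rk (F :\: A)) ->
  ~ lattice_decomposable M F.
Proof.
move=> fF h /(decomposable_rank circ_loopless circ_flat1 fF)[A [sA A0 AF]].
rewrite leqNgt h // ?card_gt0 //; apply: contra AF => /eqP e0.
by rewrite eqEsubset sA /= -setD_eq0 e0.
Qed.

Lemma card_setDI (X A F : {set E}) : A \subset F ->
  #|(F :\: A) :&: X| = #|F :&: X| - #|A :&: X| /\ #|A :&: X| <= #|F :&: X|.
Proof.
move=> sA; split; last by rewrite subset_leq_card ?setSI.
rewrite setIDAC cardsD -setIA [X :&: A]setIC setIA (setIidPr sA).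
by [].
Qed.

(** Reduces connectedness to arithmetic on the block counts of the two sides of a split. Any side
    with counts 0, 0, 10 is charged one unit, since it may be one of the [ccirc f]. *)
Lemma connected_num F : flat M F ->
  (forall p1 q1 s1 p2 q2 s2, p1 + p2 = p F -> q1 + q2 = q F -> s1 + s2 = s F ->
     0 < p1 + q1 + s1 -> 0 < p2 + q2 + s2 ->
     circ_rk F + ((p1 == 0) && (q1 == 0) && (s1 == 10))
       + ((p2 == 0) && (q2 == 0) && (s2 == 10))
     < minn 10 (minn 7 (minn 4 p1 + q1) + s1)
       + minn 10 (minn 7 (minn 4 p2 + q2) + s2)) ->
  ~ lattice_decomposable M F.
Proof.
have arith (c cA cD x1 x2 b1 b2 : nat) :
    x1 - b1 <= cA -> x2 - b2 <= cD -> c + b1 + b2 < x1 + x2 -> c < cA + cD.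
  by clear; lia.
move=> fF h; apply: connected_flat => // A sA A0 FA0.
have [pD lep] := card_setDI blk1 sA; have [qD leq] := card_setDI blk2 sA.
have [sD les] := card_setDI blk3 sA.
have low B : laminar_rk B - ((p B == 0) && (q B == 0) && (s B == 10)) <= circ_rk B.
  case: (circ_rk_cases B) => [->|[-> p0 q0 s0]]; first exact: leq_subr.
  by rewrite /laminar_rk p0 q0 s0.
have lA := low A; have lD := low (F :\: A).
have := h (p A) (q A) (s A) (p (F :\: A)) (q (F :\: A)) (s (F :\: A)).
rewrite -!card_blocks => /(_ _ _ _ A0 FA0) hh.
have eP : p A + p (F :\: A) = p F by rewrite pD subnKC.
have eQ : q A + q (F :\: A) = q F by rewrite qD subnKC.
have eS : s A + s (F :\: A) = s F by rewrite sD subnKC.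
exact: arith lA lD (hh eP eQ eS).
Qed.

Lemma connected_set1 e : ~ lattice_decomposable M [set e].
Proof.
apply: connected_flat (circ_flat1 e) _ => A sA A0 FA0.
have := subset_leq_card sA; have := cardsID A [set e].
by rewrite (setIidPr sA) cards1; lia.
Qed.

Lemma connected_blk1 : ~ lattice_decomposable M blk1.
Proof.
apply: connected_num circ_flat_blk1 _ => p1 q1 s1 p2 q2 s2.
by case: num_blk1 => -> -> ->; rewrite circ_rk_blk1; lia.
Qed.

Lemma connected_blk12 : ~ lattice_decomposable M blk12.
Proof.
apply: connected_num circ_flat_blk12 _ => p1 q1 s1 p2 q2 s2.
by case: num_blk12 => -> -> ->; rewrite circ_rk_blk12; lia.
Qed.

Lemma connected_T : ~ lattice_decomposable M setT.
Proof.
apply: connected_num (flatT M) _ => p1 q1 s1 p2 q2 s2.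
by case: num_T => -> -> ->; rewrite circ_rk_T; lia.
Qed.

Lemma connected_ccirc f : ~ lattice_decomposable M (ccirc f).
Proof.
apply: connected_num (circ_flat_ccirc f) _ => p1 q1 s1 p2 q2 s2.
by case: (is_circ_num (is_circ_ccirc f)) => -> -> ->; rewrite circ_rk_ccirc; lia.
Qed.

Definition circ_G : {set {set E}} :=
  [set [set e] | e : E] :|: [set blk1; blk12; setT] :|: [set ccirc f | f : 'I_7].

(** The rank inequality makes [e] a coloop of [F], and an indecomposable flat with a coloop is a
    singleton. *)
Lemma drop_set1 F e : e \in F -> laminar_rk (F :\ e) < circ_rk F ->
  ~ lattice_decomposable M F -> flat M F -> F \in circ_G.
Proof.
move=> eF lt_rk nd fF; have [->|ne] := eqVneq F [set e].
  by rewrite !inE imset_f.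
case: nd; apply: coloop_decomposable circ_loopless fF eF ne _.
exact: leq_ltn_trans (circ_rk_le _) lt_rk.
Qed.

(** Capacities are examined from the outside in. If the current capacity is attained, [F] is the
    corresponding flag member by comparison of ranks; if not, any element of the current block is a
    coloop, so either [F] is a singleton or it avoids that block and the next capacity is
    considered. *)
Lemma connected_in_G F : flat M F -> F != set0 -> ~ lattice_decomposable M F ->
  F \in circ_G.
Proof.
move=> fF F0 nd.
have num X e : e \in F -> #|F :&: X| = (e \in X) + #|(F :\ e) :&: X|.
  by move=> eF; rewrite -card_setU1I ?setD1K // !inE eqxx.
have drop e : e \in F -> laminar_rk (F :\ e) < circ_rk F -> F \in circ_G.
  by move=> eF lt; apply: drop_set1 eF lt nd fF.
have [/is_circP[f ->]|/circ_rk_notcirc rF] := boolP (is_circ F).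
  by rewrite inE imset_f ?orbT.
have [ge10|lt10] := leqP 10 (laminar_rk F).
  have -> : F = setT by apply: (flat_eq fF); rewrite ?subsetT //= circ_rk_T rF.
  by rewrite !inE eqxx !orbT.
have [s0|] := posnP (s F); last first.
  rewrite card_gt0 => /set0Pn[e /setIP[eF e3]].
  have /andP[n1 n2] : (e \notin blk1) && (e \notin blk2).
    by move: e3; rewrite !inE; case: (e) => [[]|].
  apply: (drop e eF); move: lt10; rewrite rF /laminar_rk !(num _ e eF) e3.
  by rewrite (negbTE n1) (negbTE n2); clear; lia.
have n3 e : e \in F -> e \notin blk3.
  move=> eF; apply/negP => e3; have /eqP := s0; rewrite cards_eq0 => /eqP/setP/(_ e).
  by rewrite in_setI eF e3 inE.
have [ge7|lt7] := leqP 7 (laminar_rk F).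
  have -> : F = blk12.
    apply: (flat_eq fF); last by rewrite /= circ_rk_blk12 rF.
    apply/subsetP => e /n3; have := blk_cases e; rewrite [_ \in blk12]in_setU.
    by case: (e \in blk1); case: (e \in blk2); case: (e \in blk3).
  by rewrite !inE eqxx !orbT.
have [q0|] := posnP (q F); last first.
  rewrite card_gt0 => /set0Pn[e /setIP[eF e2]].
  have /andP[n1 n3'] : (e \notin blk1) && (e \notin blk3).
    by move: e2; rewrite !inE; case: (e) => [[]|].
  apply: (drop e eF); move: lt7; rewrite rF /laminar_rk !(num _ e eF) e2.
  by rewrite (negbTE n1) (negbTE n3'); clear; lia.
have s1 e : e \in F -> e \in blk1.
  move=> eF; have := n3 e eF; have := blk_cases e.
  have : e \notin blk2.
    apply/negP => e2; have /eqP := q0; rewrite cards_eq0 => /eqP/setP/(_ e).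
    by rewrite in_setI eF e2 inE.
  by case: (e \in blk1); case: (e \in blk2); case: (e \in blk3).
have [ge4|lt4] := leqP 4 (laminar_rk F).
  have -> : F = blk1.
    apply: (flat_eq fF); last by rewrite /= circ_rk_blk1 rF.
    by apply/subsetP => e /s1.
  by rewrite !inE eqxx !orbT.
have /set0Pn[e eF] := F0; have e1 := s1 e eF.
have /andP[n2 n3'] : (e \notin blk2) && (e \notin blk3).
  by move: e1; rewrite !inE; case: (e) => [[]|].
apply: (drop e eF); move: lt4; rewrite rF /laminar_rk !(num _ e eF) e1.
by rewrite (negbTE n2) (negbTE n3'); clear; lia.
Qed.

Lemma G_min_circ : G_min M = circ_G.
Proof.
have gmin F : flat M F -> 0 < circ_rk F -> ~ lattice_decomposable M F ->
    F \in G_min M.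
  move=> fF F0 nd; rewrite inE fF /=; apply/andP; split; last exact/asboolP.
  by apply: contraTneq F0 => ->; rewrite circ_rk0.
apply/setP => F; apply/idP/idP.
  by rewrite inE => /and3P[fF F0 /asboolP]; apply: connected_in_G.
case/setUP => [/setUP[/imsetP[e _ ->]|]|/imsetP[f _ ->]].
- by apply: gmin; [exact: circ_flat1 | rewrite circ_rk_small cards1 | exact: connected_set1].
- case/setUP => [/setUP[]|] /set1P ->.
  + by apply: gmin; [exact: circ_flat_blk1 | rewrite circ_rk_blk1 | exact: connected_blk1].
  + by apply: gmin; [exact: circ_flat_blk12 | rewrite circ_rk_blk12 | exact: connected_blk12].
  + by apply: gmin; [exact: flatT | rewrite circ_rk_T | exact: connected_T].
by apply: gmin; [exact: circ_flat_ccirc | rewrite circ_rk_ccirc | exact: connected_ccirc].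
Qed.

Lemma matroid_example : exists (E : finType) (M : matroid E) (h : {poly nat}),
  [/\ loopless M, chow_hilbert M (G_min M) h & ~ log_concave h].
Proof.
have nsub f : ~~ (blk1 \subset ccirc f).
  apply/negP => /subset_trans/(_ (ccirc_sub f))/sub_blk3[p0 _ _].
  by case: num_blk1; rewrite p0.
have injC : injective ccirc.
  move=> f g /setP/(_ (inr (f, ord0))); rewrite !inE eqxx.
  by move/esym/eqP.
(* The value [a = 4] and the seven circuit-hyperplanes are the least allowed by [3 < a] and
   [6 < N]. *)
have [] := chow_flag_not_log_concave (a := 4) _ circ_loopless circ_flat1
  circ_flat_blk1 circ_flat_blk12 circ_flat_ccirc circ_rk_blk1 circ_rk_blk12 circ_rk_T circ_rk_ccirc
  (subsetUl _ _) nsub injC (erefl circ_G) => // h [ch lc].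
by exists _, M, h; rewrite G_min_circ; split=> //; apply: circ_loopless.
Qed.

End ConcreteMatroid.

Theorem theorem1p6 :
  (exists (E : finType) (M : matroid E) (h : {poly nat}),
     [/\ loopless M, chow_hilbert M (G_min M) h & ~ log_concave h])
  /\
  (exists N : nat, forall n : nat, N <= n ->
     exists (G : {set {set 'I_n}}) (h : {poly nat}),
       [/\ building_set (boolean_matroid n) G,
           chow_hilbert (boolean_matroid n) G h
         & ~ log_concave h]).
Proof.
split; first exact: matroid_example.
by exists 13; apply: boolean_example.
Qed.
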